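(* Let $\mathfrak g$ be an affine Lie algebra of type $X^{(r)}_N$ (any type in the list in the context). Fix $1\le b\le n$, $l\in\mathbb Z_{\ge1}$ and $\mu=\mu_1\alpha_1+\cdots+\mu_n\alpha_n\in\bigoplus_{c=1}^n\mathbb Z_{\ge0}\,\alpha_c/\epsilon_c$. For each $1\le a\le n$ with $(\alpha_a|\alpha_b)<0$ let the affine Lie algebra $\mathfrak g^\ast$, the index $a^\ast$ and the element $\mu^\ast$ be as defined in the context. Then, in the $q$-adic topology, $$\lim_{L\to\infty}M_\infty\bigl((W^{(b)}_l)^{\otimes L},\,Ll\,\overline{\Lambda}_b-\mu,\,q^{-1}\bigr)=\sum_\nu\frac{q^{t^\vee_b\psi(\nu)/\epsilon_b}}{\prod_{i\ge1}(q_b)_{\nu_i}}\prod_{\substack{1\le a\le n\\(\alpha_a|\alpha_b)<0}}\mathcal M^{(a^\ast)}_{q^\ast,\nu^\ast}(\mathfrak g^\ast\,|\,\mu^\ast),$$ where $$\psi(\nu)=\sum_{i,j\ge1}\min(i,j)\nu_i\nu_j,\qquad \nu^\ast=\{\nu^\ast_j\}_{j\ge1},\quad \nu^\ast_j=-\frac{(\tilde\alpha_a|\tilde\alpha_b)}{t^\vee_a}\sum_{k\ge1}\nu_kB_{bk,aj}\ (\in\mathbb Z_{\ge0}),$$ $q^\ast=q_a$ if $\mathfrak g^\ast=A^{(1)}_{n'}$ for some $n'$ and $q^\ast=q$ otherwise, and the sum is over $\nu_1,\nu_2,\ldots\in\mathbb Z_{\ge0}$ such that $\sum_{i\ge1}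i\nu_i=\epsilon_b\mu_b$.
   Context: **Affine data.** $\mathfrak g=X^{(r)}_N$ is one of $A^{(1)}_n\,(n\ge1)$, $B^{(1)}_n\,(n\ge3)$, $C^{(1)}_n\,(n\ge2)$, $D^{(1)}_n\,(n\ge4)$, $E^{(1)}_{6,7,8}$, $F^{(1)}_4$, $G^{(1)}_2$, $A^{(2)}_{2n}\,(n\ge1)$, $A^{(2)}_{2n-1}\,(n\ge2)$, $D^{(2)}_{n+1}\,(n\ge2)$, $E^{(2)}_6$, $D^{(3)}_4$; $n$ is its rank (nodes $0,\dots,n$). $\overset{\circ}{\mathfrak g}$ is obtained by deleting node $0$: it is $X_N$ for $r=1$, and $C_n,C_n,B_n,F_4,G_2$ for $A^{(2)}_{2n},A^{(2)}_{2n-1},D^{(2)}_{n+1},E^{(2)}_6,D^{(3)}_4$. $\mathfrak g_{\overline0}$ equals $\overset{\circ}{\mathfrak g}$ except that $\mathfrak g_{\overline0}=B_n$ for $A^{(2)}_{2n}$ ($B_1=A_1$ when $n=1$). Numbering of nodes $1,\dots,n$: $A_n$: chain; $B_n$: chain, $\alpha_n$ short; $C_n$: chain, $\alpha_n$ long; $D_n$: chain $1,\dots,n-2$ with $n-2$ joined to $n-1$ and $n$; $E_6$: chain $1,\dots,5$, node $6$ joined to $3$; $E_7$: chain $1,\dots,6$, node $7$ joined to $3$; $E_8$: chain $1,\dots,7$, node $8$ joined to $5$; $F_4$: chain $1,2,3,4$ with $\alpha_1,\alpha_2$ long for $F^{(1)}_4$ and $\alpha_1,\alpha_2$ short for $E^{(2)}_6$;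 $G_2$: $\alpha_1$ long, $\alpha_2$ short for $G^{(1)}_2$, and $\alpha_1$ short, $\alpha_2$ long for $D^{(3)}_4$. Integers $t_a$ ($1\le a\le n$): $t_n=2$ for $B^{(1)}_n$; $t_a=2$ for $a<n$ for $C^{(1)}_n$; $t_3=t_4=2$ for $F^{(1)}_4$; $t_2=3$ for $G^{(1)}_2$; all other $t_a=1$. Integers $t^\vee_a$: $t^\vee_a=2$ for all $a$ for $A^{(2)}_{2n}$; $t^\vee_n=2$ for $A^{(2)}_{2n-1}$; $t^\vee_a=2$ for $a<n$ for $D^{(2)}_{n+1}$; $t^\vee_3=t^\vee_4=2$ for $E^{(2)}_6$; $t^\vee_2=3$ for $D^{(3)}_4$; all other $t^\vee_a=1$. $\epsilon_a=2$ if $\mathfrak g=A^{(2)}_{2n}$ and $a=n$; $\epsilon_a=1$ otherwise. Put $q_a=q^{t^\vee_a}$, $(x)_k=\prod_{i=1}^k(1-x^i)$, and $B_{bk,aj}=2\min(t_ak,t_bj)-\min(t_ak,t_b(j+1))-\min(t_ak,t_b(j-1))$. $\alpha_a,\overline{\Lambda}_a$ are the simple roots and fundamental weights of $\overset{\circ}{\mathfrak g}$; $\overline P=\bigoplus\mathbb Z\overline{\Lambda}_a$. $\tilde\alpha_a,\tilde\Lambda_a$ are those of $\mathfrak g_{\overline0}$ (same numbering), with invariant form $(\cdot|\cdot)$ normalized so that long roots have square length $2r$ (for $A^{(2)}_2$: $(\tilde\alpha_1|\tilde\alpha_1)=2$); equivalently $\frac{\epsilon_at_a}{t^\vee_a}(\tilde\alpha_a|\tilde\alpha_b)$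 is the Cartan matrix $2(\tilde\alpha_a|\tilde\alpha_b)/(\tilde\alpha_a|\tilde\alpha_a)$ of $\mathfrak g_{\overline0}$. $(\alpha_a|\alpha_b)<0$ means that nodes $a\ne b$ are adjacent. $\iota$ is the linear map with $\iota(\overline{\Lambda}_a)=\epsilon_a\tilde\Lambda_a$; then $\iota(\alpha_a)=\epsilon_a\tilde\alpha_a$. **Fermionic form.** For $\nu^{(a)}_j\in\mathbb Z_{\ge0}$ ($1\le a\le n$, $j\ge1$), finitely many non-zero, recorded by the formal symbol $W=\bigotimes_{a,j}(W^{(a)}_j)^{\otimes\nu^{(a)}_j}$, and $\lambda\in\overline P$ (or more generally $\lambda\in\overline P\otimes\mathbb Q$ for which the constraint below makes sense), $$M_\infty(W,\lambda,q)=\sum_{\{m\}}q^{c(\{m\})}\prod_{a=1}^n\prod_{i\ge1}\left[\begin{array}{c}p^{(a)}_i+m^{(a)}_i\\ m^{(a)}_i\end{array}\right]_{q_a},$$ $$c(\{m\})=\tfrac12\sum_{a,b=1}^n\sum_{j,k\ge1}(\tilde\alpha_a|\tilde\alpha_b)\min(t_bj,t_ak)m^{(a)}_jm^{(b)}_k-\sum_{a=1}^nt^\vee_a\sum_{j,k\ge1}\min(j,k)\nu^{(a)}_jm^{(a)}_k,$$ $$p^{(a)}_i=\sum_{j\ge1}\nu^{(a)}_j\min(i,j)-\frac1{t^\vee_a}\sum_{b=1}^n\sum_{k\ge1}(\tilde\alpha_a|\tilde\alpha_b)\min(t_bi,t_ak)m^{(b)}_k,$$ summed over $m^{(a)}_i\in\mathbb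 Z_{\ge0}$ with all $p^{(a)}_i\ge0$ and $\sum_{a,i}i\,m^{(a)}_i\tilde\alpha_a=\iota\bigl(\sum_{a,i}i\nu^{(a)}_i\overline{\Lambda}_a-\lambda\bigr)$. Here $\left[\begin{array}{c}p+m\\ m\end{array}\right]_q=\prod_{i=1}^m\frac{1-q^{p+i}}{1-q^i}$. $M_\infty(W,\lambda,q^{-1})$ is obtained by substituting $q\mapsto q^{-1}$. For one node $a$, a sequence $\nu=\{\nu_j\}_{j\ge1}$ of non-negative integers with finitely many non-zero terms, and $\mu\in\bigoplus_c\mathbb Z_{\ge0}\alpha_c/\epsilon_c$, set $$\mathcal M^{(a)}_{q,\nu}(\mathfrak g\,|\,\mu)=M_\infty\Bigl(\bigotimes_{j\ge1}(W^{(a)}_j)^{\otimes\nu_j},\ \sum_{j\ge1}j\nu_j\overline{\Lambda}_a-\mu,\ q\Bigr),$$ the right side being computed for the affine Lie algebra $\mathfrak g$. **Definition of $\mathfrak g^\ast,a^\ast,\mu^\ast$.** Remove the vertices $0$ and $b$ and all edges attached to them from the Dynkin diagram of $\mathfrak g$. The result is a disjoint union of connected diagrams $D_a$, one for each $a$ with $(\alpha_a|\alpha_b)<0$, where $D_a$ contains the vertex $a$. For each such $a$: if $D_a$ is the Dynkin diagram of $A_{n'}$, then $\mathfrak g^\ast=A^{(\epsilon_a)}_{\epsilon_an'}$ (so it is $A^{(1)}_{n'}$ when $\epsilon_a=1$, and $A^{(2)}_2$ in the only case $\epsilon_a=2$, where $n'=1$). Otherwise $\mathfrak g^\ast$ is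 the affine Lie algebra such that the Dynkin diagram of $\overset{\circ}{\mathfrak g}{}^\ast$ together with the numbers $t^\vee_c$ ($c\neq0$) of $\mathfrak g^\ast$ coincides with $D_a$ together with the numbers $t^\vee_c$ of $\mathfrak g$ for $c\in D_a$. Let $c\mapsto c^\ast\in\{1,\dots,\mathrm{rank}\,\mathfrak g^\ast\}$ be the resulting identification of the vertices of $D_a$ with the non-zero nodes of $\mathfrak g^\ast$ (numbered, with $s=\mathrm{rank}\,\mathfrak g^\ast$, according to the type of $\overset{\circ}{\mathfrak g}{}^\ast$ as follows: $A_s$: chain $1,\dots,s$ (a single node $1$ for $A^{(1)}_1$ and $A^{(2)}_2$); $B_s$: chain $1,\dots,s$, $\alpha_s$ short; $C_s$: chain $1,\dots,s$, $\alpha_s$ long; $D_s$: chain $1,\dots,s-2$ with $s-2$ joined to $s-1$ and $s$; $E_6$: chain $1,\dots,5$, node $6$ joined to $3$; $E_7$: chain $1,\dots,6$, node $7$ joined to $3$; no other types occur). $a^\ast$ is the image of $a$, and $\mu^\ast=\sum_{c\in D_a}\mu_c\,\alpha_{c^\ast}$ is the projection of $\mu$ to the root space of $\overset{\circ}{\mathfrak g}{}^\ast$. (The data $\mathfrak g^\ast,\mu^\ast,\nu^\ast,q^\ast$ all depend on $a$.) *)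

(* Defs.v *)
From HB Require Import structures.
From mathcomp Require Import all_boot all_order all_algebra.
From mathcomp Require Import fraction.
From mathcomp Require Import boolp classical_sets functions cardinality fsbigop.

Set Implicit Arguments.
Unset Strict Implicit.
Unset Printing Implicit Defensive.

Import Order.TTheory GRing.Theory Num.Theory.

Local Open Scope classical_set_scope.
Local Open Scope ring_scope.

(** * Finite Dynkin diagrams

    Vertices are numbered from 1 by natural numbers.  [FF4 true] has alpha_1,
    alpha_2 long, [FF4 false] has them short; [FG2 true] has alpha_1 long and
    alpha_2 short, [FG2 false] the opposite. *)

Inductive dynkin : Type :=
| FA of nat | FB of nat | FC of nat | FD of nat
| FE6 | FE7 | FE8 | FF4 of bool | FG2 of bool.

Definition edge (X : dynkin) (i j : nat) : bool :=
  match X with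
  | FA _ | FB _ | FC _ | FF4 _ | FG2 _ => j == i.+1
  | FD n => ((j == i.+1) && (j < n)%N) || ((i == n - 2)%N && (j == n))
  | FE6 => ((j == i.+1) && (j <= 5)%N) || ((i == 3) && (j == 6))
  | FE7 => ((j == i.+1) && (j <= 6)%N) || ((i == 3) && (j == 7))
  | FE8 => ((j == i.+1) && (j <= 7)%N) || ((i == 5) && (j == 8))
  end.

Definition adj (X : dynkin) (i j : nat) : bool := edge X i j || edge X j i.

(** Relative square lengths of simple roots: 1 for short roots (and for all
    roots in the simply laced case), [long_len X] for long roots. *)
Definition long_len (X : dynkin) : nat :=
  match X with
  | FA _ | FD _ | FE6 | FE7 | FE8 => 1
  | FB _ | FC _ | FF4 _ => 2
  | FG2 _ => 3
  end.

Definition is_short (X : dynkin) (i : nat) : bool :=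
  match X with
  | FA _ | FD _ | FE6 | FE7 | FE8 => true
  | FB n => i == n
  | FC n => i != n
  | FF4 b => if b then (2 < i)%N else (i <= 2)%N
  | FG2 b => if b then i == 2 else i == 1
  end.

Definition root_len (X : dynkin) (i : nat) : nat :=
  if is_short X i then 1 else long_len X.

(** The invariant form on simple roots in the normalization of [root_len].  For
    adjacent vertices one of the two Cartan integers 2(i|j)/(i|i), 2(i|j)/(j|j),
    the one relative to the longer root, equals -1. *)
Definition rel_form (X : dynkin) (i j : nat) : rat :=
  if i == j then (root_len X i)%:R
  else if adj X i j then - ((maxn (root_len X i) (root_len X j))%:R / 2)
  else 0.

Definition cartan_entry (X : dynkin) (i j : nat) : rat :=
  2 * rel_form X i j / rel_form X i i.

(** * Affine data *)

(** [A1 n], ..., [G21] are A_n^(1), ..., G_2^(1);  [A2e n] is A_{2n}^(2),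
    [A2o n] is A_{2n-1}^(2), [D2 n] is D_{n+1}^(2), [E62] is E_6^(2), [D43] is
    D_4^(3). *)
Inductive affine : Type :=
| A1 of nat | B1 of nat | C1 of nat | D1 of nat
| E61 | E71 | E81 | F41 | G21
| A2e of nat | A2o of nat | D2 of nat | E62 | D43.

Definition affine_ok (g : affine) : bool :=
  match g with
  | A1 n => (1 <= n)%N
  | B1 n => (3 <= n)%N
  | C1 n => (2 <= n)%N
  | D1 n => (4 <= n)%N
  | A2e n => (1 <= n)%N
  | A2o n => (2 <= n)%N
  | D2 n => (2 <= n)%N
  | _ => true
  end.

Definition rank (g : affine) : nat :=
  match g with
  | A1 n | B1 n | C1 n | D1 n | A2e n | A2o n | D2 n => n
  | E61 => 6 | E71 => 7 | E81 => 8 | F41 => 4 | G21 => 2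
  | E62 => 4 | D43 => 2
  end.

(** The superscript r of X_N^(r). *)
Definition twist (g : affine) : nat :=
  match g with
  | A2e _ | A2o _ | D2 _ | E62 => 2
  | D43 => 3
  | _ => 1
  end.

(** The diagram with vertex 0 deleted (for [A2e 1] this is C_1 = A_1). *)
Definition circ (g : affine) : dynkin :=
  match g with
  | A1 n => FA n | B1 n => FB n | C1 n => FC n | D1 n => FD n
  | E61 => FE6 | E71 => FE7 | E81 => FE8 | F41 => FF4 true | G21 => FG2 true
  | A2e n => FC n | A2o n => FC n | D2 n => FB n
  | E62 => FF4 false | D43 => FG2 false
  end.

(** The diagram of g_{\bar 0}. *)
Definition bar0 (g : affine) : dynkin :=
  if g is A2e n then FB n else circ g.

(** The nodes 1, ..., n: [a : node g] stands for the node with number [a.+1]. *)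
Notation node g := 'I_(rank g).

Definition t (g : affine) (a : node g) : nat :=
  let k := a.+1 in
  match g with
  | B1 n => if k == n then 2 else 1
  | C1 n => if (k < n)%N then 2 else 1
  | F41 => if (3 <= k)%N then 2 else 1
  | G21 => if k == 2 then 3 else 1
  | _ => 1
  end.

Definition tv (g : affine) (a : node g) : nat :=
  let k := a.+1 in
  match g with
  | A2e _ => 2
  | A2o n => if k == n then 2 else 1
  | D2 n => if (k < n)%N then 2 else 1
  | E62 => if (3 <= k)%N then 2 else 1
  | D43 => if k == 2 then 3 else 1
  | _ => 1
  end.

Definition eps (g : affine) (a : node g) : nat :=
  if g is A2e n then if a.+1 == n then 2 else 1 else 1.

(** (alpha_a|alpha_b) < 0. *)
Definition adjacent (g : affine) (a b : node g) : bool := adj (circ g) a.+1 b.+1.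

Definition cartan (g : affine) (a b : node g) : rat :=
  cartan_entry (circ g) a.+1 b.+1.

(** (tilde alpha_a | tilde alpha_b), normalized so that long roots have square
    length 2r.  For [A2e 1] the unique simple root counts as the short root of
    B_1, so its square length is 2. *)
Definition form (g : affine) (a b : node g) : rat :=
  (2 * twist g)%:R / (long_len (bar0 g))%:R * rel_form (bar0 g) a.+1 b.+1.

(** ** Weights

    An element of P (x) Q of the algebra [circ g] (resp. [bar0 g]) is the row of
    its coordinates in the fundamental weights. *)

Definition Lam (g : affine) (a : node g) : 'rV[rat]_(rank g) := delta_mx 0 a.

Definition alpha (g : affine) (a : node g) : 'rV[rat]_(rank g) :=
  \row_b cartan_entry (circ g) b.+1 a.+1.

Definition alpha_t (g : affine) (a : node g) : 'rV[rat]_(rank g) :=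
  \row_b cartan_entry (bar0 g) b.+1 a.+1.

Definition iota_w (g : affine) (w : 'rV[rat]_(rank g)) : 'rV[rat]_(rank g) :=
  \row_a ((eps a)%:R * w 0 a).

(** * Fermionic form *)

Definition pos : set nat := [set i | (0 < i)%N].

(** Sums over i >= 1 of functions with finite support, and products over i >= 1
    of functions that are 1 for all but finitely many i. *)
Definition sum_pos (V : nmodType) (f : nat -> V) : V := \sum_(i \in pos) f i.

Definition prod_pos (F : fieldType) (f : nat -> F) : F :=
  \big[*%R/1]_(i \in pos) f i.

(** A finitely supported sequence (m_i)_{i >= 1} of natural numbers is a function
    on [nat] with the dummy value [m 0] fixed to 0. *)
Definition fin_seq (m : nat -> nat) : Prop :=
  m 0%N = 0%N /\ finite_set [set i | m i != 0%N].

Section Fermionic.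
Variable F : fieldType.

(** (x)_k *)
Definition qpoch (x : F) (k : nat) : F := \prod_(1 <= i < k.+1) (1 - x ^+ i).

(** The q-binomial [p + m, m]_x. *)
Definition qbin (x : F) (p m : nat) : F :=
  \prod_(1 <= i < m.+1) ((1 - x ^+ (p + i)) / (1 - x ^+ i)).

Variable g : affine.
Variable nu : node g -> nat -> nat.

Definition charge (m : node g -> nat -> nat) : rat :=
  2^-1 * (\sum_(a : node g) \sum_(b : node g)
           sum_pos (fun j => sum_pos (fun k =>
             form a b * (minn (t b * j) (t a * k))%:R * (m a j)%:R * (m b k)%:R)))
  - \sum_(a : node g) (tv a)%:R *
      sum_pos (fun j => sum_pos (fun k =>
        (minn j k)%:R * (nu a j)%:R * (m a k)%:R)).

Definition vacancy (m : node g -> nat -> nat) (a : node g) (i : nat) : rat :=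
  sum_pos (fun j => (nu a j)%:R * (minn i j)%:R)
  - (tv a)%:R^-1 *
    \sum_(b : node g) sum_pos (fun k =>
      form a b * (minn (t b * i) (t a * k))%:R * (m b k)%:R).

Definition admissible (lambda : 'rV[rat]_(rank g)) (m : node g -> nat -> nat)
    : Prop :=
  [/\ forall a, fin_seq (m a),
      forall a i, (0 < i)%N -> 0 <= vacancy m a i
    & \sum_(a : node g) sum_pos (fun i => i%:R * (m a i)%:R) *: alpha_t a =
      iota_w (\sum_(a : node g) sum_pos (fun i => i%:R * (nu a i)%:R) *: Lam a
              - lambda)].

(** M_infty(W, lambda, x), where W is recorded by [nu].  [charge m] and the
    [vacancy m a i] are integers, so that [Num.floor] and [Num.truncn] (the
    latter on nonnegative arguments) only change their type.  The variable x may
    be any element of a field, e.g. q, q_a or q^-1. *)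
Definition M_infty (lambda : 'rV[rat]_(rank g)) (x : F) : F :=
  \sum_(m \in [set m | admissible lambda m])
    x ^ (Num.floor (charge m)) *
    \prod_(a : node g)
      prod_pos (fun i =>
        qbin (x ^+ tv a) (Num.truncn (vacancy m a i)) (m a i)).

End Fermionic.

(** The symbol W = bigotimes_j (W^(a)_j)^{nu_j} at a single node [a]. *)
Definition at_node (g : affine) (a : node g) (nu : nat -> nat)
    : node g -> nat -> nat :=
  fun c j => if c == a then nu j else 0%N.

(** calligraphic M^(a)_{x,nu}(g | mu) *)
Definition calM (F : fieldType) (g : affine) (a : node g) (nu : nat -> nat)
    (mu : 'rV[rat]_(rank g)) (x : F) : F :=
  M_infty (at_node a nu) (sum_pos (fun j => j%:R * (nu j)%:R) *: Lam a - mu) x.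

(** * The algebra g^*, the node a^* and the element mu^* *)

(** D_a: the connected component of [a] after removing the vertex [b]. *)
Definition component (g : affine) (b a : node g) : {set node g} :=
  [set c | connect [rel x y : node g | [&& adjacent x y, x != b & y != b]] a c]%SET.

(** [D], as a full subdiagram of [circ g], is the Dynkin diagram A_k. *)
Definition is_typeA (g : affine) (D : {set node g}) (k : nat) : Prop :=
  exists f : 'I_k -> node g,
    [/\ injective f, forall c, (exists i, f i = c) <-> c \in D
      & forall i j, cartan (f i) (f j) = cartan_entry (FA k) i.+1 j.+1].

(** A candidate for g^*, with the inverse of the identification c |-> c^* and the
    node a^*. *)
Record star_datum (g : affine) := StarDatum {
  st_alg : affine;
  st_map : node st_alg -> node g;
  st_node : node st_alg
}.

(** g^* is determined by this only up to the renumbering A_3^(2) = D_3^(2), and the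
    identification up to automorphisms of the diagram D_a. *)
Record is_star (g : affine) (b a : node g) (S : star_datum g) : Prop := IsStar {
  st_ok : affine_ok (st_alg S);
  st_inj : injective (@st_map _ S);
  st_image : forall c, (exists d : node (st_alg S), st_map d = c) <-> c \in component b a;
  st_cartan : forall c d : node (st_alg S), cartan (st_map c) (st_map d) = cartan c d;
  st_typeA : forall k, is_typeA (component b a) k ->
    st_alg S = if eps a == 1%N then A1 k else A2e k;
  st_not_typeA : (forall k, ~ is_typeA (component b a) k) ->
    forall c : node (st_alg S), tv (st_map c) = tv c;
  st_nodeE : st_map (st_node S) = a
}.

Definition mu_star (g : affine) (mu : node g -> rat) (S : star_datum g)
    : 'rV[rat]_(rank (st_alg S)) :=
  \sum_(c : node (st_alg S)) mu (st_map c) *: alpha c.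

Definition Bcoef (g : affine) (b : node g) (k : nat) (a : node g) (j : nat) : int :=
  2 * (minn (t a * k) (t b * j))%:Z
  - (minn (t a * k) (t b * j.+1))%:Z - (minn (t a * k) (t b * j.-1))%:Z.

(** nu^*_j; the rational number under [Num.truncn] is a nonnegative integer. *)
Definition nu_star (g : affine) (b a : node g) (nu : nat -> nat) (j : nat) : nat :=
  if j is 0 then 0%N else
  Num.truncn (- (form a b / (tv a)%:R) *
              sum_pos (fun k => (nu k)%:R * (Bcoef b k a j)%:~R)).

Definition q_star (F : fieldType) (q : F) (g : affine) (a : node g)
    (S : star_datum g) : F :=
  if st_alg S is A1 _ then q ^+ tv a else q.

Definition psi (nu : nat -> nat) : nat :=
  sum_pos (fun i => sum_pos (fun j => (minn i j * nu i * nu j)%N)).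

(** * The q-adic topology

    All quantities live in Q(q), the fraction field of Q[q]. *)

Notation ratfun := {fraction {poly rat}}.

Definition qvar : ratfun := tofrac ('X : {poly rat}).

(** Convergence for the q-adic valuation: the difference is eventually in
    q^N Q[q]_(q) for every N. *)
Definition qadic_cvg (u : nat -> ratfun) (l : ratfun) : Prop :=
  forall N : nat, exists L0 : nat, forall L : nat, (L0 <= L)%N ->
    exists f h : {poly rat},
      h.[0] != 0 /\ u L - l = qvar ^+ N * (tofrac f / tofrac h).

(* Main.v *)
(** Substituting q -> 1/q turns [p + m, m] into q^(-pm) [p + m, m], and since the p's are affine in the
    m's the total exponent becomes the quadratic form Q(m)/2, independent of L.  The weight constraint
    is sum_i i m_i^(c) = eps_c mu_c for every c (the simple roots are linearly independent), so only
    finitely many m occur; as L grows only the vacancy numbers of the node b grow, whence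
    [p + m_i^(b), m_i^(b)] -> 1 / (q_b)_{m_i^(b)}.  Put nu = m^(b).  Deleting b from the tree leaves the
    components D_a, which interact in Q(m) and in the vacancy numbers only through nu.  To p_i^(a)
    the node b contributes sum_j nu^*_j min(i, j), because nu^* is, up to sign, the second difference of
    j |-> min(t_a k, t_b j); so the sum over the m's living on D_a is the fermionic form of g^*, and the
    whole sum factorizes. *)
From mathcomp Require Import all_boot all_order all_algebra.
From mathcomp Require Import fraction.
From mathcomp Require Import boolp classical_sets functions cardinality fsbigop.
From mathcomp Require Import zify ring lra.
Require Import Defs.

Set Implicit Arguments.
Unset Strict Implicit.
Unset Printing Implicit Defensive.

Import Order.TTheory GRing.Theory Num.Theory.

Local Open Scope classical_set_scope.
Local Open Scope ring_scope.

(** * Affine data *)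

(** The obstacle is that g^* is known only through its Cartan matrix and the numbers tv: its t and
    its form may differ from those of g on D_a. The short node of B_n^(1) has t = 2 and square
    length 1; as the node of A_1^(1) it has t = 1 and square length 2. Charges and vacancy numbers,
    however, involve only the form multiplied by a minimum ([kern]), and the identity form(a,b) t_a
    eps_b = tv_a C_ab shows that this product is determined by the Cartan matrix, tv and eps. From
    g^* to g it changes by a single factor v, which q^* = q^v compensates. Such numerical facts are
    local to an edge or a node, so they are checked on finite tables valid for all types and ranks.
    The weight constraint does not involve L. One bound K on the weights therefore encodes all
    configurations, for g and for every g^*, in one finite type. Both sides become sums over the
    same configurations of g, differing only in the factor and the constraint at b, and the limit is
    taken term by term. *)

Definition edge_data (g : affine) (a b : node g) :=
  ((t a, t b), (tv a, tv b), (eps a, eps b), (form a b, cartan a b, cartan b a)).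
Definition edge_values : eqType :=
  ((nat * nat) * (nat * nat) * (nat * nat) * (rat * rat * rat))%type.

Definition edge_swap (x : edge_values) : edge_values :=
  let: ((t1, t2), (v1, v2), (e1, e2), (f, c, c')) := x in
  ((t2, t1), (v2, v1), (e2, e1), (f, c', c)).

(* Up to exchanging the two ends, all values of [edge_data] on adjacent nodes. *)
Definition edge_table : seq edge_values :=
  [:: ((1, 1)%N, (1, 1)%N, (1, 1)%N, (- 1, - 1, - 1));
      ((2, 2)%N, (1, 1)%N, (1, 1)%N, (- 2^-1, - 1, - 1));
      ((1, 2)%N, (1, 1)%N, (1, 1)%N, (- 1, - 1, - 2));
      ((1, 3)%N, (1, 1)%N, (1, 1)%N, (- 1, - 1, - 3));
      ((1, 1)%N, (2, 2)%N, (1, 1)%N, (- 2, - 1, - 1));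
      ((1, 1)%N, (2, 2)%N, (2, 1)%N, (- 2, - 1, - 2));
      ((1, 1)%N, (2, 1)%N, (1, 1)%N, (- 2, - 1, - 2));
      ((1, 1)%N, (3, 1)%N, (1, 1)%N, (- 3, - 1, - 3))].

Lemma adjacent_sym g (a b : node g) : adjacent a b = adjacent b a.
Proof. by rewrite /adjacent /adj orbC. Qed.

Lemma rel_form_sym X i j : rel_form X i j = rel_form X j i.
Proof. rewrite /rel_form eq_sym /adj orbC maxnC; case: eqP => // ->; exact. Qed.

Lemma form_sym g (a b : node g) : form a b = form b a.
Proof. by rewrite /form rel_form_sym. Qed.

Lemma edge_data_swap g (a b : node g) : edge_data b a = edge_swap (edge_data a b).
Proof. by rewrite /edge_data /= form_sym. Qed.

Lemma edge_lt X i j : affine_ok X -> edge (circ X) i j -> (0 < i)%N -> (j <= rank X)%N -> (i < j)%N.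
Proof. case: X => [n|n|n|n| | | | | |n|n|n| |] //=; lia. Qed.

Lemma adj_irr g (a : node g) : affine_ok g -> adjacent a a = false.
Proof.
move=> ok; apply/negP; rewrite /adjacent /adj orbb => /(edge_lt ok)/(_ (ltn0Sn _) (ltn_ord a)).
by rewrite ltnn.
Qed.

Lemma adjacent_bar0 g (a b : node g) : adj (bar0 g) a.+1 b.+1 = adjacent a b.
Proof. by case: g a b. Qed.

(** Named and sealed against simplification, so that the case analysis on types only reduces the
    natural-number entries; the rational entries are evaluated by [vm_compute] once every test has
    been decided. *)
Definition edge_form (r L k : nat) : rat := (2 * r)%:R / L%:R * - (k%:R / 2).
Definition edge_cartan (k l : nat) : rat := 2 * - (k%:R / 2) / l%:R.
Definition in_edge_table x := (x \in edge_table) || (edge_swap x \in edge_table).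
Arguments edge_form : simpl never.
Arguments edge_cartan : simpl never.
Arguments in_edge_table : simpl never.

Lemma edge_dataE g (a b : node g) : affine_ok g -> adjacent a b ->
  let l x := root_len (circ g) (x : node g).+1 in
  let l' x := root_len (bar0 g) (x : node g).+1 in
  edge_data a b = ((t a, t b), (tv a, tv b), (eps a, eps b),
    (edge_form (twist g) (long_len (bar0 g)) (maxn (l' a) (l' b)),
     edge_cartan (maxn (l a) (l b)) (l a), edge_cartan (maxn (l a) (l b)) (l b))).
Proof.
move=> ok ab l l'; rewrite /edge_data /form /cartan /cartan_entry.
have ne : (a.+1 == b.+1) = false.
  by apply/eqP => -[] /ord_inj e; move: ab; rewrite e adj_irr.
have ab' := ab; rewrite -adjacent_bar0 in ab'; rewrite /adjacent in ab.
have ba : adj (circ g) b.+1 a.+1 by rewrite /adj orbC.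
by rewrite /rel_form (eq_sym b.+1) ne !eqxx ab' ab ba [maxn _ (root_len (circ g) a.+1)]maxnC.
Qed.

Lemma edge_dataP g (a b : node g) : affine_ok g -> adjacent a b ->
  in_edge_table (edge_data a b).
Proof.
(* In an oriented edge [a] carries the smaller number, hence is never the last vertex n, which
   decides the tests against n for [a]. The other orientation is covered by [edge_swap]. *)
move=> ok; wlog: a b / edge (circ g) a.+1 b.+1.
  move=> W; rewrite /adjacent /adj => /orP[] e; first by apply: W; rewrite // /adjacent /adj e.
  rewrite /in_edge_table orbC -edge_data_swap.
  have -> : edge_data a b = edge_swap (edge_data b a) by rewrite -edge_data_swap.
  by apply: W; rewrite // /adjacent /adj e.
move=> e /(edge_dataE ok) ->; have lt_ab := edge_lt ok e (ltn0Sn _) (ltn_ord b).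
case: a b lt_ab e => [a la] [b lb] /=.
rewrite /root_len /t /tv /eps.
case: g ok la lb => [n|n|n|n| | | | | |n|n|n| |] /= ok la lb lt_ab.
all: move=> e.
- vm_compute; reflexivity.
- have -> : (a.+1 == n) = false by apply/eqP; lia.
  case: (b.+1 == n); vm_compute; reflexivity.
- have -> : (a.+1 < n)%N = true by lia.
  have -> : (b.+1 < n)%N = (b.+1 != n) by lia.
  have -> : (a.+1 == n) = false by apply/eqP; lia.
  case: (b.+1 == n); vm_compute; reflexivity.
- vm_compute; reflexivity.
- vm_compute; reflexivity.
- vm_compute; reflexivity.
- vm_compute; reflexivity.
- move: a b {la} lb lt_ab {e} => [|[|[|[|a]]]] [|[|[|[|b]]]] lb lt_ab; first [exfalso; lia | vm_compute; reflexivity].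
- move: a b {la} lb lt_ab {e} => [|[|a]] [|[|b]] lb lt_ab; first [exfalso; lia | vm_compute; reflexivity].
- have -> : (a.+1 == n) = false by apply/eqP; lia.
  case: (b.+1 == n); vm_compute; reflexivity.
- have -> : (a.+1 == n) = false by apply/eqP; lia.
  case: (b.+1 == n); vm_compute; reflexivity.
- have -> : (a.+1 < n)%N = true by lia.
  have -> : (b.+1 < n)%N = (b.+1 != n) by lia.
  have -> : (a.+1 == n) = false by apply/eqP; lia.
  case: (b.+1 == n); vm_compute; reflexivity.
- move: a b {la} lb lt_ab {e} => [|[|[|[|a]]]] [|[|[|[|b]]]] lb lt_ab; first [exfalso; lia | vm_compute; reflexivity].
- move: a b {la} lb lt_ab {e} => [|[|a]] [|[|b]] lb lt_ab; first [exfalso; lia | vm_compute; reflexivity].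
Qed.

(** The common tool for numerical facts about adjacent nodes: a Boolean property of the edge values
    is tested by computation on the rows and their swaps, whatever the type and the rank. *)
Lemma edge_ind (P : pred _) : all (fun x => P x && P (edge_swap x)) edge_table ->
  forall g (a b : node g), affine_ok g -> adjacent a b -> P (edge_data a b).
Proof.
move=> /allP Pt g a b ok ab; have /orP[/Pt/andP[]//|/Pt/andP[_]] := edge_dataP ok ab.
by rewrite /edge_data /edge_swap.
Qed.

Definition node_data (g : affine) (a : node g) := (t a, tv a, eps a, form a a).

Definition node_table : seq (nat * nat * nat * rat) :=
  [:: (1%N, 1%N, 1%N, 2); (2%N, 1%N, 1%N, 1); (3%N, 1%N, 1%N, 2 / 3);
      (1%N, 2%N, 1%N, 4); (1%N, 2%N, 2%N, 2); (1%N, 3%N, 1%N, 6)].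

Definition node_form (r L k : nat) : rat := (2 * r)%:R / L%:R * k%:R.
Definition in_node_table x := x \in node_table.
Arguments node_form : simpl never.
Arguments in_node_table : simpl never.

Lemma node_dataP g (a : node g) : affine_ok g -> in_node_table (node_data a).
Proof.
move=> ok; rewrite /node_data /form /rel_form eqxx -/(node_form _ _ _).
case: a => [a la]; rewrite /root_len /t /tv /eps.
case: g ok la => [n|n|n|n| | | | | |n|n|n| |] /= ok la.
all: try (have -> : (a.+1 < n)%N = (a.+1 != n) by lia).
all: try case: (a.+1 == n).
all: try (move: a la => [|[|[|[|[|[|[|[|a]]]]]]]] la; first [exfalso; lia | idtac]).
all: try (vm_compute; lazymatch goal with |- true = true => reflexivity end).
Qed.

Lemma node_ind (P : pred _) : all P node_table ->
  forall g (a : node g), affine_ok g -> P (node_data a).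
Proof. by move=> /allP Pt g a ok; apply: Pt; apply: node_dataP. Qed.

Lemma t_gt0 g (a : node g) : affine_ok g -> (0 < t a)%N.
Proof. by apply: (@node_ind (fun x => 0 < x.1.1.1)%N). Qed.

Lemma tv_gt0 g (a : node g) : affine_ok g -> (0 < tv a)%N.
Proof. by apply: (@node_ind (fun x => 0 < x.1.1.2)%N). Qed.

Lemma eps_gt0 g (a : node g) : affine_ok g -> (0 < eps a)%N.
Proof. by apply: (@node_ind (fun x => 0 < x.1.2)%N). Qed.

Lemma eps_dvd_tv g (a : node g) : affine_ok g -> (eps a %| tv a)%N.
Proof. by apply: (@node_ind (fun x => x.1.2 %| x.1.1.2)%N). Qed.

Lemma cartan_diag g (a : node g) : cartan a a = 2.
Proof.
rewrite /cartan /cartan_entry /rel_form eqxx mulfK // pnatr_eq0.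
by rewrite /root_len; case: ifP => // _; case: (circ g).
Qed.

Lemma nonadj_cartan0 g (a b : node g) : a != b -> ~~ adjacent a b -> cartan a b = 0.
Proof.
move=> ab /negPf nab; rewrite /cartan /cartan_entry /rel_form eqSS val_eqE (negPf ab).
by rewrite /adjacent in nab; rewrite nab mulr0 mul0r.
Qed.

Lemma nonadj_form0 g (a b : node g) : a != b -> ~~ adjacent a b -> form a b = 0.
Proof.
move=> ab /negPf nab; rewrite /form /rel_form eqSS val_eqE (negPf ab).
by rewrite adjacent_bar0 nab mulr0.
Qed.

Lemma form_diag g (a : node g) : affine_ok g ->
  form a a * (t a * eps a)%:R = (2 * tv a)%:R.
Proof.
move=> ok; apply/eqP.
apply: (@node_ind (fun x => x.2 * (x.1.1.1 * x.1.2)%:R == (2 * x.1.1.2)%:R)) ok.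
by vm_compute.
Qed.

(** The normalization makes [eps a * t a / tv a] times the form the Cartan matrix of [bar0 g];
    passing to that of [circ g] moves eps from the row [a] to the column [b]. Hence t_a times the
    form depends only on tv, eps and the Cartan matrix. *)
Lemma form_cartan g (a b : node g) : affine_ok g ->
  form a b * (t a * eps b)%:R = (tv a)%:R * cartan a b.
Proof.
move=> ok; have [->|ab] := eqVneq a b; first by rewrite form_diag // cartan_diag natrM mulrC.
have [adj|nadj] := boolP (adjacent a b); last first.
  by rewrite nonadj_form0 // nonadj_cartan0 // mul0r mulr0.
apply/eqP; move: ok adj.
apply: (@edge_ind (fun x => x.2.1.1 * (x.1.1.1.1 * x.1.2.2)%:R == x.1.1.2.1%:R * x.2.1.2)).
by vm_compute.
Qed.

Lemma adjacent_form_lt0 g (a b : node g) : affine_ok g -> adjacent a b -> form a b < 0.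
Proof. by apply: (@edge_ind (fun x => x.2.1.1 < 0)); vm_compute. Qed.

Lemma adjacent_cartan_lt0 g (a b : node g) : affine_ok g -> adjacent a b -> cartan a b < 0.
Proof. by apply: (@edge_ind (fun x => x.2.1.2 < 0)); vm_compute. Qed.

Lemma adjacentE g (a b : node g) : affine_ok g -> adjacent a b = (a != b) && (cartan a b != 0).
Proof.
move=> ok; have [->|ab] := eqVneq a b; first by rewrite adj_irr.
have [adj|/nonadj_cartan0 ->] := boolP (adjacent a b); rewrite ?eqxx //.
by rewrite lt_eqF // adjacent_cartan_lt0.
Qed.

Lemma sym_edge_tv g (a b : node g) : affine_ok g -> adjacent a b ->
  cartan a b = cartan b a -> tv a = tv b.
Proof.
move=> ok ab /eqP e; apply/eqP; move: ok ab e.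
have H := @edge_ind (fun x => (x.2.1.2 == x.2.2) ==> (x.1.1.2.1 == x.1.1.2.2)).
by move=> ok ab; apply/implyP; apply: H ok ab; vm_compute.
Qed.

Lemma sym_edge_eps g (a b : node g) : affine_ok g -> adjacent a b ->
  cartan a b = cartan b a -> eps a = eps b.
Proof.
move=> ok ab /eqP e; apply/eqP; move: ok ab e.
have H := @edge_ind (fun x => (x.2.1.2 == x.2.2) ==> (x.1.2.1 == x.1.2.2)).
by move=> ok ab; apply/implyP; apply: H ok ab; vm_compute.
Qed.

(** Outside type A the definition of g^* does not mention eps. It is recovered here from what g^*
    inherits: tv at both ends of an edge and one Cartan integer. *)
Lemma eps_edge g (a b : node g) : affine_ok g -> adjacent a b ->
  eps a = if [&& tv a == 2%N, tv b == 2%N & cartan b a == - 2] then 2%N else 1%N.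
Proof.
move=> ok ab; apply/eqP; move: ok ab.
by apply: (@edge_ind (fun x =>
  x.1.2.1 == if [&& x.1.1.2.1 == 2%N, x.1.1.2.2 == 2%N & x.2.2 == - 2] then 2%N else 1%N)); vm_compute.
Qed.

(* C_ab / (t_a eps_b) is an integer unless t_a = t_b, in which case t_a divides min (t_b i, t_a k). *)
Lemma kernel_int g (a b : node g) (i k : nat) : affine_ok g ->
  form a b * (minn (t b * i) (t a * k))%:R / (tv a)%:R \is a Num.int.
Proof.
move=> ok.
have tn0 : (t a)%:R != 0 :> rat by rewrite pnatr_eq0 -lt0n t_gt0.
have en0 : (eps b)%:R != 0 :> rat by rewrite pnatr_eq0 -lt0n eps_gt0.
have vn0 : (tv a)%:R != 0 :> rat by rewrite pnatr_eq0 -lt0n tv_gt0.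
have -> : form a b = (tv a)%:R * (cartan a b / ((t a)%:R * (eps b)%:R)).
  by apply: (mulIf (mulf_neq0 tn0 en0)); rewrite -natrM form_cartan // natrM -mulrA divfK ?mulf_neq0.
rewrite mulrAC [_%:R * _]mulrC mulfK //.
have : (cartan a b / ((t a)%:R * (eps b)%:R) \is a Num.int) ||
    (t a == t b) && (cartan a b / ((t a)%:R * (eps b)%:R) * (t a)%:R \is a Num.int).
  have [<-|ab] := eqVneq a b.
    rewrite eqxx /= orbC cartan_diag.
    have -> : 2 / ((t a)%:R * (eps a)%:R) * (t a)%:R = 2 / (eps a)%:R :> rat.
      by field; rewrite !pnatr_eq0 -!lt0n eps_gt0 // t_gt0.
    suff -> : 2 / (eps a)%:R \is a @Num.int rat by [].
    by rewrite Qint_def; apply: (@node_ind (fun x => denq (2 / x.1.2%:R) == 1)) ok; vm_compute.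
  have [adj|/nonadj_cartan0 H] := boolP (adjacent a b); last by rewrite H // mul0r rpred0.
  rewrite !Qint_def; move: ok adj; apply: (@edge_ind (fun x =>
    (denq (x.2.1.2 / (x.1.1.1.1%:R * x.1.2.2%:R)) == 1) || (x.1.1.1.1 == x.1.1.1.2) &&
    (denq (x.2.1.2 / (x.1.1.1.1%:R * x.1.2.2%:R) * x.1.1.1.1%:R) == 1))); by vm_compute.
case/orP => [ci|/andP[/eqP tt ci]]; first by rewrite rpredM // rpred_nat.
by rewrite -tt -minnMr natrM mulrA rpredM // rpred_nat.
Qed.

(** * Linear independence of the simple roots *)

Lemma sum_supp (V : nmodType) (I : eqType) (r s : seq I) (F : I -> V) :
  uniq r -> uniq s -> (forall j, F j != 0 -> (j \in r) = (j \in s)) ->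
  \sum_(j <- r) F j = \sum_(j <- s) F j.
Proof.
move=> ur us H; pose P j := F j != 0.
have X q : \sum_(j <- q) F j = \sum_(j <- filter P q) F j.
  rewrite big_filter [RHS]big_mkcond /=; apply: eq_bigr => j _.
  by rewrite /P; case: eqP.
rewrite (X r) (X s); apply: perm_big; apply: uniq_perm; rewrite ?filter_uniq // => j.
by rewrite !mem_filter /P; case: (eqVneq (F j) 0) => //= /H ->.
Qed.

(* The coordinates numbered from 1 as in [edge], extended by 0. *)
Definition ext0 n (y : 'I_n -> rat) (k : nat) : rat :=
  if k is j.+1 then oapp y 0 (insub j) else 0.

Lemma ext0S n (y : 'I_n -> rat) (c : 'I_n) : ext0 y c.+1 = y c.
Proof. by rewrite /ext0 valK. Qed.

Lemma ext0_out n (y : 'I_n -> rat) k : (n < k)%N -> ext0 y k = 0.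
Proof. by case: k => //= k nk; rewrite insubF //; lia. Qed.

(** Since [ext0] vanishes outside 1, ..., n, the list [s] may contain 0 or n + 1, so the rows at the
    ends of a chain have the same three-term shape as the inner ones. *)
Lemma cartan_row n X (y : 'I_n -> rat) (i : nat) (s : seq nat) : uniq s ->
  (forall j, j \notin s -> i != j /\ adj X i j = false) ->
  (forall b : 'I_n, \sum_(c < n) cartan_entry X b.+1 c.+1 * y c = 0) -> (0 < i <= n)%N ->
  \sum_(j <- s) cartan_entry X i j * ext0 y j = 0.
Proof.
move=> us Hs H; case: i Hs => // i Hs /= ile; rewrite -[RHS](H (Ordinal ile)).
under [RHS]eq_bigr do rewrite -ext0S.
rewrite -(big_mkord predT (fun c => cartan_entry X i.+1 c.+1 * ext0 y c.+1)).
rewrite -(big_add1 _ _ 0 n.+1 predT (fun c => cartan_entry X i.+1 c * ext0 y c)).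
apply: sum_supp; rewrite ?iota_uniq // => j Fj.
rewrite mem_index_iota.
have -> : j \in s.
  apply: contraR Fj => /Hs [/negPf ne na].
  by rewrite /cartan_entry /rel_form ne na mulr0 mul0r mul0r.
symmetry; apply: contraR Fj; rewrite negb_and -leqNgt -leqNgt leqn0 => /orP[/eqP->|nj].
  by rewrite mulr0.
by rewrite ext0_out // mulr0.
Qed.

Lemma chain_linear (Y : nat -> rat) m : Y 0 = 0 ->
  (forall i, (0 < i < m)%N -> 2 * Y i = Y i.-1 + Y i.+1) ->
  forall k, (k <= m)%N -> Y k = k%:R * Y 1%N.
Proof.
move=> Y0 H k; elim/ltn_ind: k => -[_ _|[_ _|k IH km]]; rewrite ?mul0r ?mul1r //.
have := H k.+1 km; rewrite /= (IH k) ?(IH k.+1); try lia.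
have -> : k.+2%:R = k%:R + 2 :> rat by rewrite -addn2 natrD.
have -> : k.+1%:R = k%:R + 1 :> rat by rewrite -addn1 natrD.
by move=> h; lra.
Qed.

Lemma cartan_entry_diag X i : cartan_entry X i i = 2.
Proof.
rewrite /cartan_entry /rel_form eqxx mulfK // pnatr_eq0.
by rewrite /root_len; case: ifP => // _; case: X.
Qed.

Lemma cartan_entry_adj X i j : i != j -> adj X i j ->
  cartan_entry X i j = - (maxn (root_len X i) (root_len X j))%:R / (root_len X i)%:R.
Proof.
move=> /negPf ne ij; rewrite /cartan_entry /rel_form ne ij eqxx.
by congr (_ / _); rewrite mulrN [2 * _]mulrC divfK.
Qed.

Definition centry (k l : nat) : rat := - (maxn k l)%:R / k%:R.
Arguments centry : simpl never.

Lemma cartan_entryE X i j : cartan_entry X i j =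
  if i == j then 2 else if adj X i j then centry (root_len X i) (root_len X j) else 0.
Proof.
have [->|ij] := eqVneq i j; first by rewrite cartan_entry_diag.
case: ifP => [|ij']; first exact: cartan_entry_adj.
by rewrite /cartan_entry /rel_form (negPf ij) ij' mulr0 mul0r.
Qed.

Lemma centryE : (centry 1 1 = - 1) * (centry 1 2 = - 2) * (centry 2 1 = - 1) * (centry 2 2 = -1) *
  (centry 1 3 = - 3) * (centry 3 1 = - 1).
Proof. by do ! split; vm_compute. Qed.

Definition dynkin_ok X n : bool :=
  match X with
  | FA m | FC m => (m == n) && (0 < n)%N
  | FB m => (m == n) && (1 < n)%N
  | FD m => (m == n) && (3 < n)%N
  | FE6 => n == 6%N
  | FE7 => n == 7%N
  | FE8 => n == 8%N
  | FF4 _ => n == 4%N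
  | FG2 _ => n == 2%N
  end.

Lemma circ_ok g : affine_ok g -> dynkin_ok (circ g) (rank g).
Proof. by case: g => //= m; rewrite eqxx //=; lia. Qed.

(** Along the simply laced stretch of a chain starting at vertex 1 the rows say that second
    differences vanish; as Y 0 = 0, this gives Y k = k Y 1, and the rows at the far end force Y 1 =
    0. For the exceptional diagrams the finitely many rows are solved by linear arithmetic. *)
Lemma cartan_nondeg n X (y : 'I_n -> rat) : dynkin_ok X n ->
  (forall b : 'I_n, \sum_(c < n) cartan_entry X b.+1 c.+1 * y c = 0) ->
  forall c, y c = 0.
Proof.
move=> ok H.
suff Z k : ext0 y k = 0 by move=> c; rewrite -ext0S.
have Y0 : ext0 y 0 = 0 by [].
have Yn k' : (n < k')%N -> ext0 y k' = 0 by exact: ext0_out.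
have R i s := fun us Hs => cartan_row (i := i) (s := s) us Hs H.
move: {y H} (ext0 y) Y0 Yn R => Y Y0 Yn R.
have [{}/Yn //|kn] := ltnP n k.
have fin0 m : (forall k, (k <= m)%N -> Y k = k%:R * Y 1%N) -> Y 1%N = 0 -> (k <= m)%N -> Y k = 0.
  by move=> L Y1 km; rewrite L // Y1 mulr0.
have chain_row i : (forall j, adj X i.+1 j = (j == i) || (j == i.+2)) -> (i < n)%N ->
    2 * Y i.+1 = (maxn (root_len X i.+1) (root_len X i))%:R / (root_len X i.+1)%:R * Y i
               + (maxn (root_len X i.+1) (root_len X i.+2))%:R / (root_len X i.+1)%:R * Y i.+2.
  move=> Hi lin; have := R i.+1 [:: i; i.+1; i.+2]; rewrite !big_cons big_nil.
  rewrite cartan_entry_diag !cartan_entry_adj ?Hi ?eqxx ?orbT; try lia.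
  move=> HR; apply/eqP; rewrite -subr_eq0; apply/eqP; rewrite -[RHS]HR //.
  - by ring.
  - by rewrite /= !inE; lia.
  - by move=> j; rewrite !inE Hi; lia.
case: X ok R chain_row => [m|m|m|m| | | |o|o] /= ok R chain_row;
  try (case/andP: ok => /eqP em ok); try (move/eqP: ok => em); subst n.
- have C i : (0 < i < m.+1)%N -> 2 * Y i = Y i.-1 + Y i.+1.
    case: i => // i; rewrite ltnS /= => im; rewrite chain_row //= ?divff ?mul1r //.
    by move=> j; rewrite /adj /=; lia.
  have L := chain_linear Y0 C; apply: fin0 (L) _ _; last by lia.
  have := L m.+1 (leqnn _); rewrite Yn // => /esym/eqP; rewrite mulf_eq0 pnatr_eq0 /=.
  by move/eqP.
- have C i : (0 < i < m)%N -> 2 * Y i = Y i.-1 + Y i.+1.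
    case: i => // i /= im; rewrite chain_row //=; try lia; last by move=> j; rewrite /adj /=; lia.
    rewrite /root_len /=; have -> : (i.+1 == m) = false by lia.
    have -> : (i == m) = false by lia.
    by case: ifP => _ /=; rewrite divff ?mul1r.
  have L := chain_linear Y0 C; apply: fin0 (L) _ _ => //.
  case: m {R C ok kn} chain_row L Yn ok => // -[] // m CR L Yn _.
  have := CR m.+1; rewrite /root_len /= eqxx (L m.+2) // (Yn m.+3) // (L m.+1) //.
  have -> : (m.+1 == m.+2) = false by lia.
  have -> : m.+2%:R = m.+1%:R + 1 :> rat by rewrite -addn1 natrD.
  have X j : adj (FB m.+2) m.+2 j = (j == m.+1) || (j == m.+3) by rewrite /adj /=; lia.
  move=> /(_ X (leqnn _)); rewrite /maxn /= mulr0 addr0 divr1; move: (m.+1%:R) => a h; lra.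
- have C i : (0 < i < m.-1)%N -> 2 * Y i = Y i.-1 + Y i.+1.
    case: i => // i /= im; rewrite chain_row //=; try lia; last by move=> j; rewrite /adj /=; lia.
    rewrite /root_len /=; have -> : (i.+1 != m) by lia.
    have -> : (i != m) by lia. have -> : (i.+2 != m) by lia.
    by rewrite /= divff ?mul1r.
  have L := chain_linear Y0 C.
  case: m {C} R ok kn chain_row L Yn => // -[|m] R _ km CR L Yn.
    have := CR 0%N _ isT; rewrite Y0 (Yn 2%N) // !mulr0 addr0 => h.
    have Y1 : Y 1%N = 0 by suff : 2 * Y 1%N = 0 by [lra]; apply: h => j; rewrite /adj /=; lia.
    by case: k {fin0} km => [|[|k]] // _; rewrite ?Y1.
  clear R.
  have X i j : adj (FC m.+2) i.+1 j = (j == i) || (j == i.+2) by rewrite /adj /=; lia.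
  have := CR m.+1 (X _) (leqnn _); have := CR m (X _) (leqnSn _); rewrite /root_len /= eqxx.
  have -> : (m.+1 == m.+2) = false by lia.
  have -> : (m == m.+2) = false by lia.
  rewrite /maxn /= (L m) // (L m.+1) // (Yn m.+3) //.
  have -> : m.+1%:R = m%:R + 1 :> rat by rewrite -addn1 natrD.
  move=> e1 e2; have Y1 : Y 1%N = 0 by lra.
  have [km1|->] : (k <= m.+1)%N \/ k = m.+2 by lia.
    by apply: fin0 (L) Y1 km1.
  by move: e1 e2; rewrite Y1 !mulr0 => e1 e2; lra.
- have C i : (0 < i < m.-2)%N -> 2 * Y i = Y i.-1 + Y i.+1.
    case: i => // i /= im; rewrite chain_row //=; try lia; last by move=> j; rewrite /adj /=; lia.
    by rewrite /root_len /= divff ?mul1r.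
  have L := chain_linear Y0 C.
  case: m {C} R ok kn chain_row L Yn => // -[] // -[] // -[] // m R _ km CR L Yn.
  have adjE i j : adj (FD m.+4) i j = edge (FD m.+4) i j || edge (FD m.+4) j i by [].
  have := R m.+2 [:: m.+1; m.+2; m.+3; m.+4]; have := R m.+3 [:: m.+2; m.+3];
    have := R m.+4 [:: m.+2; m.+4].
  rewrite !big_cons !big_nil !cartan_entry_diag !cartan_entry_adj ?adjE /=; try lia.
  rewrite (L m.+1) // (L m.+2) // !addr0 !mulN1r.
  have -> : m.+2%:R = m%:R + 2 :> rat by rewrite -addn2 natrD.
  have -> : m.+1%:R = m%:R + 1 :> rat by rewrite -addn1 natrD.
  move=> h1 h2 h3.
  have {}h1 : - ((m%:R + 2) * Y 1%N) + 2 * Y m.+4 = 0.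
    by apply: h1 => //=; [rewrite !inE; lia | move=> j; rewrite !inE adjE /=; lia].
  have {}h2 : - ((m%:R + 2) * Y 1%N) + 2 * Y m.+3 = 0.
    by apply: h2 => //=; [rewrite !inE; lia | move=> j; rewrite !inE adjE /=; lia].
  have {}h3 : - ((m%:R + 1) * Y 1%N) + (2 * ((m%:R + 2) * Y 1%N) + (- Y m.+3 - Y m.+4)) = 0.
    by apply: h3 => //=; [rewrite !inE; lia | move=> j; rewrite !inE adjE /=; lia | lia].
  have Y1 : Y 1%N = 0 by lra.
  move: h1 h2; rewrite Y1 !mulr0 oppr0 !add0r => h1 h2.
  have [km1|[->|->]] : (k <= m.+2)%N \/ k = m.+3 \/ k = m.+4 by lia.
  - by apply: fin0 (L) Y1 km1.
  - by lra.
  - by lra.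
- have Rc i : (0 < i <= 6)%N -> \sum_(j <- iota 0 8) cartan_entry FE6 i j * Y j = 0.
    by move=> i6; apply: R => // j; rewrite mem_iota /adj /=; lia.
  clear chain_row fin0; have := Rc 1%N isT; have := Rc 2%N isT; have := Rc 3%N isT;
    have := Rc 4%N isT; have := Rc 5%N isT; have := Rc 6%N isT.
  rewrite /= !big_cons !big_nil !cartan_entryE /= !centryE Y0 (Yn 7%N) //.
  by case: k kn => [|[|[|[|[|[|[|k]]]]]]] kn *; first [lra | exfalso; lia].
- have Rc i : (0 < i <= 7)%N -> \sum_(j <- iota 0 9) cartan_entry FE7 i j * Y j = 0.
    by move=> i6; apply: R => // j; rewrite mem_iota /adj /=; lia.
  clear chain_row fin0; have := Rc 1%N isT; have := Rc 2%N isT; have := Rc 3%N isT;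
    have := Rc 4%N isT; have := Rc 5%N isT; have := Rc 6%N isT; have := Rc 7%N isT.
  rewrite /= !big_cons !big_nil !cartan_entryE /= !centryE Y0 (Yn 8%N) //.
  by case: k kn => [|[|[|[|[|[|[|[|k]]]]]]]] kn *; first [lra | exfalso; lia].
- have Rc i : (0 < i <= 8)%N -> \sum_(j <- iota 0 10) cartan_entry FE8 i j * Y j = 0.
    by move=> i6; apply: R => // j; rewrite mem_iota /adj /=; lia.
  clear chain_row fin0; have := Rc 1%N isT; have := Rc 2%N isT; have := Rc 3%N isT;
    have := Rc 4%N isT; have := Rc 5%N isT; have := Rc 6%N isT; have := Rc 7%N isT;
    have := Rc 8%N isT.
  rewrite /= !big_cons !big_nil !cartan_entryE /= !centryE Y0 (Yn 9%N) //.
  by case: k kn => [|[|[|[|[|[|[|[|[|k]]]]]]]]] kn *; first [lra | exfalso; lia].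
- have Rc i : (0 < i <= 4)%N -> \sum_(j <- iota 0 6) cartan_entry (FF4 o) i j * Y j = 0.
    by move=> i6; apply: R => // j; rewrite mem_iota /adj /=; lia.
  clear chain_row fin0; have := Rc 1%N isT; have := Rc 2%N isT; have := Rc 3%N isT;
    have := Rc 4%N isT.
  case: o {R Rc}; rewrite /= !big_cons !big_nil !cartan_entryE /= !centryE Y0 (Yn 5%N) //;
  case: k kn => [|[|[|[|[|k]]]]] kn *; first [lra | exfalso; lia].
- have Rc i : (0 < i <= 2)%N -> \sum_(j <- iota 0 4) cartan_entry (FG2 o) i j * Y j = 0.
    by move=> i6; apply: R => // j; rewrite mem_iota /adj /=; lia.
  clear chain_row fin0; have := Rc 1%N isT; have := Rc 2%N isT.
  case: o {R Rc}; rewrite /= !big_cons !big_nil !cartan_entryE /= !centryE Y0 (Yn 3%N) //;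
  case: k kn => [|[|[|k]]] kn *; first [lra | exfalso; lia].
Qed.

(** This is iota(alpha_a) = eps_a tilde alpha_a in coordinates, obtained by comparing [form_cartan]
    with the diagonal value of the form. *)
Lemma bar0_cartan g (a b : node g) : affine_ok g ->
  cartan_entry (bar0 g) b.+1 a.+1 * (eps a)%:R = cartan b a * (eps b)%:R.
Proof.
move=> ok.
have tn0 : (t b)%:R != 0 :> rat by rewrite pnatr_eq0 -lt0n t_gt0.
have en0 : (eps b)%:R != 0 :> rat by rewrite pnatr_eq0 -lt0n eps_gt0.
have vn0 : (tv b)%:R != 0 :> rat by rewrite pnatr_eq0 -lt0n tv_gt0.
have f1 := form_cartan b a ok; have f2 := form_diag b ok.
have fn0 : form b b != 0.
  apply: contra_eqN f2 => /eqP ->; rewrite mul0r eq_sym natrM mulf_neq0 //.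
have -> : cartan_entry (bar0 g) b.+1 a.+1 = 2 * form b a / form b b.
  move: fn0; rewrite /form /cartan_entry; move: (_ / _) => s; rewrite mulf_eq0 negb_or => /andP[s0 r0].
  by field; rewrite r0 s0.
apply: (mulIf (mulf_neq0 (mulf_neq0 fn0 tn0) vn0)).
have -> : 2 * form b a / form b b * (eps a)%:R * (form b b * (t b)%:R * (tv b)%:R) =
   2 * (form b a * (t b * eps a)%:R) * (tv b)%:R by rewrite natrM; field.
rewrite f1; move: f2; rewrite !natrM => f2.
have -> : cartan b a * (eps b)%:R * (form b b * (t b)%:R * (tv b)%:R) =
   cartan b a * (form b b * ((t b)%:R * (eps b)%:R)) * (tv b)%:R by ring.
by rewrite f2; ring.
Qed.

Lemma weight_eq g (s x : node g -> rat) : affine_ok g ->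
  (\sum_(a : node g) s a *: alpha_t a = iota_w (\sum_(a : node g) x a *: alpha a)) <->
  (forall a, s a = (eps a)%:R * x a).
Proof.
move=> ok.
have en0 c : (eps (c : node g))%:R != 0 :> rat by rewrite pnatr_eq0 -lt0n eps_gt0.
have L b : (\sum_(a : node g) s a *: alpha_t a) 0 b = \sum_a s a / (eps a)%:R * (cartan b a * (eps b)%:R).
  rewrite summxE; apply: eq_bigr => a _; rewrite !mxE -bar0_cartan //.
  by rewrite mulrACA mulVf ?mulr1.
have R b : iota_w (\sum_(a : node g) x a *: alpha a) 0 b = \sum_a x a * (cartan b a * (eps b)%:R).
  rewrite mxE summxE mulr_sumr; apply: eq_bigr => a _; rewrite !mxE.
  by rewrite -/(cartan b a); ring.
split=> [/matrixP E a|E].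
  have Z : forall b : node g, \sum_(c < rank g) cartan_entry (circ g) b.+1 c.+1 * (s c / (eps c)%:R - x c) = 0.
    move=> b; have := E 0 b; rewrite L R => /eqP; rewrite -subr_eq0 -sumrB => /eqP.
    under eq_bigr do rewrite -mulrBl [_ * (cartan _ _ * _)]mulrA.
    rewrite -mulr_suml => /eqP; rewrite mulf_eq0 (negPf (en0 b)) orbF => /eqP Z.
    by rewrite -[RHS]Z; apply: eq_bigr => c _; rewrite mulrC.
  have /eqP := cartan_nondeg (circ_ok ok) Z a; rewrite subr_eq0 => /eqP <-.
  by rewrite mulrC divfK.
apply/matrixP => i b; rewrite (ord1 i) L R; apply: eq_bigr => a _.
by rewrite E [_ / _]mulrAC divff ?mul1r.
Qed.

(** * The components D_a and the data of g^* *)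

Lemma connect_first (T : finType) (e : rel T) x y : connect e x y -> x != y ->
  exists2 z, e x z & connect e z y.
Proof.
case/connectP => -[|z p] /= ; first by move=> _ ->; rewrite eqxx.
by case/andP => xz ep ->; exists z => //; apply/connectP; exists p.
Qed.

Definition avoid g (b : node g) : rel (node g) :=
  [rel x y : node g | [&& adjacent x y, x != b & y != b]].

Lemma componentE g (b a c : node g) : (c \in component b a) = connect (avoid b) a c.
Proof. by rewrite inE. Qed.

Lemma avoid_sym g (b : node g) : symmetric (avoid b).
Proof. by move=> x y; rewrite /avoid /= adjacent_sym [(x != b) && _]andbC. Qed.

Lemma avoid_connect_sym g (b : node g) : connect_sym (avoid b).
Proof. exact/sym_connect_sym/avoid_sym. Qed.

Lemma component_const g (b a c : node g) (T : Type) (f : node g -> T) :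
  (forall x y, x \in component b a -> y \in component b a -> adjacent x y -> f x = f y) ->
  c \in component b a -> f c = f a.
Proof.
move=> H; rewrite componentE => /connectP [p ep ->]; elim/last_ind: p ep => // p x IH.
rewrite rcons_path last_rcons => /andP[ep ex]; rewrite -IH //.
have h : connect (avoid b) a (last a p) by apply/connectP; exists p.
have /= /andP[ad _] := ex; rewrite adjacent_sym in ad.
by apply: H; rewrite ?componentE // (connect_trans h) // connect1.
Qed.

Lemma component_nb g (b a c : node g) : a != b -> c \in component b a -> c != b.
Proof.
move=> ab; rewrite componentE => /connectP [p ep ->]; case/lastP: p ep => // p x.
by rewrite rcons_path last_rcons => /andP[_ /and3P[]].
Qed.

(* A component that is not a single vertex (type A_1) has no isolated vertex. *)
Lemma component_nbr g (b a c : node g) : (forall k, ~ is_typeA (component b a) k) ->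
  c \in component b a -> exists2 d, d \in component b a & adjacent c d.
Proof.
move=> nA cD.
have [c' c'D cc'] : exists2 c', c' \in component b a & c != c'.
  apply: contrapT => H; apply: (nA 1%N).
  have D1 d : d \in component b a -> d = c.
    by move=> dD; apply: contrapT => /eqP dc; apply: H; exists d; rewrite // eq_sym.
  exists (fun=> c); split=> [i j _|d|i j]; first by rewrite !ord1.
    by split=> [[_ <-] //|/D1 ->]; exists ord0.
  by rewrite !ord1 cartan_diag cartan_entry_diag.
have : connect (avoid b) c c'.
  by rewrite !componentE in cD c'D; rewrite (connect_trans _ c'D) // avoid_connect_sym.
case/connect_first => // d cd dc'; exists d; last by case/andP: cd.
by rewrite componentE; rewrite componentE in cD; rewrite (connect_trans cD) // connect1.
Qed.

Lemma A1_circ_typeA g (b a : node g) S k : is_star b a S -> st_alg S = A1 k ->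
  is_typeA (component b a) k.
Proof.
case=> _; case: S => G f s /= fi fD fC _ _ _ eG; subst G.
by exists f; split=> // i j; rewrite fC.
Qed.

Lemma FA_sym k i j : cartan_entry (FA k) i j = cartan_entry (FA k) j i.
Proof. by rewrite !cartan_entryE eq_sym [adj _ _ _]orbC. Qed.

Lemma typeA_cartan_sym g (D : {set node g}) k c d : is_typeA D k -> c \in D -> d \in D ->
  cartan c d = cartan d c.
Proof. by case=> f [_ fD fC] /fD [i <-] /fD [j <-]; rewrite !fC FA_sym. Qed.

Lemma eps_gt1 g (c : node g) : affine_ok g -> eps c != 1%N ->
  eps c = 2%N /\ forall d : node g, tv d = 2%N /\ (eps d != 1%N -> d = c).
Proof.
case: g c => //= n c ok; rewrite /eps; case ec: (c.+1 == n) => // _; split=> // d; split=> //.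
by case ed: (d.+1 == n) => // _; apply/val_inj => /=; lia.
Qed.

(** In type A with eps_a = 1 the edges of D_a are symmetric, so tv is constant there, while it is 1
    on A_k^(1): v = tv_a. If eps_a = 2, all tv are 2 on both sides; outside type A they agree by
    definition of g^*. In these two cases v = 1. *)
Lemma star_scale (F : fieldType) g (b a : node g) S : affine_ok g -> adjacent a b ->
  is_star b a S ->
  exists v : nat, [/\ forall q : F, q_star q a S = q ^+ v,
    forall c, tv (st_map (s := S) c) = (v * tv c)%N & forall c, eps (st_map (s := S) c) = eps c].
Proof.
move=> ok ab st; have ok' := st_ok st; have inj := st_inj st.
have A1E k (eS : st_alg S = A1 k) (c : node (st_alg S)) : tv c = 1%N /\ eps c = 1%N.
  by move: c; rewrite eS.
have A2E k (eS : st_alg S = A2e k) (c : node (st_alg S)) :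
    tv c = 2%N /\ eps c = if c.+1 == k then 2%N else 1%N.
  by move: c; rewrite eS.
have mD c : st_map (s := S) c \in component b a by apply/(st_image st); exists c.
have [[k kA]|nA] := pselect (exists k, is_typeA (component b a) k).
  have cs x y : x \in component b a -> y \in component b a -> adjacent x y -> tv x = tv y.
    by move=> xD yD xy; apply: sym_edge_tv => //; apply: typeA_cartan_sym kA _ _.
  have es x y : x \in component b a -> y \in component b a -> adjacent x y -> eps x = eps y.
    by move=> xD yD xy; apply: sym_edge_eps => //; apply: typeA_cartan_sym kA _ _.
  have cE c : c \in component b a -> tv c = tv a := component_const cs.
  have eE c : c \in component b a -> eps c = eps a := component_const es.
  have := st_typeA st kA; case: eqP => ea eS.
    exists (tv a); split=> [q|c|c]; first by rewrite /q_star eS.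
      by rewrite cE // (A1E k eS c).1 muln1.
    by rewrite eE // (A1E k eS c).2.
  move/eqP: ea => ea; have [e2 av] := eps_gt1 ok ea.
  exists 1%N; split=> [q|c|c]; first by rewrite /q_star eS expr1.
    by rewrite (av _).1 (A2E k eS c).1.
  (* All vertices of D_a have eps equal to 2, but only one node of g does; so D_a is a point and k =
     1. *)
  have c0 (d : node (st_alg S)) : c = d.
    by apply: inj; rewrite ((av (st_map c)).2 _) ?eE // ((av (st_map d)).2 _) ?eE.
  rewrite eE // e2 (A2E k eS c).2.
  have rk : rank (st_alg S) = k by rewrite eS.
  have k0 : (0 < rank (st_alg S))%N by move: ok'; rewrite eS.
  have c1 : nat_of_ord c = 0%N by rewrite (c0 (Ordinal k0)).
  have k1 : (k <= 1)%N.
    rewrite leqNgt; apply/negP => k1; rewrite -rk in k1.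
    by have := congr1 val (c0 (Ordinal k1)); rewrite /= c1.
  by rewrite c1; case: eqP => //; lia.
exists 1%N; split=> [q|c|c].
- rewrite expr1 /q_star; case E: (st_alg S) => [k| | | | | | | | | | | | |] //.
  by case: nA; exists k; apply: A1_circ_typeA st E.
- by rewrite mul1n; apply: (st_not_typeA st) => k kA; apply: nA; exists k.
have nA' k : ~ is_typeA (component b a) k by move=> kA; apply: nA; exists k.
have [d' /(st_image st)[d <-] cd] := component_nbr nA' (mD c).
have cd' : adjacent c d.
  move: cd; rewrite !adjacentE // => /andP[ne].
  by rewrite (st_cartan st) => ->; rewrite andbT; apply: contra ne => /eqP ->.
by rewrite (eps_edge ok cd) (eps_edge ok' cd') !(st_not_typeA st nA') (st_cartan st).
Qed.

(** Neither t nor the form is preserved separately; [H] scales their product by v, and this suffices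
    because the minimum can be pulled through the form. *)
Lemma star_kernel g (b a : node g) S v : affine_ok g -> is_star b a S ->
  (forall c, tv (st_map (s := S) c) = (v * tv c)%N) ->
  (forall c, eps (st_map (s := S) c) = eps c) ->
  forall c d i k, form (st_map (s := S) c) (st_map d) * (minn (t (st_map d) * i) (t (st_map c) * k))%:R
  = v%:R * (form c d * (minn (t d * i) (t c * k))%:R).
Proof.
move=> ok st Hv He c d i k; have ok' := st_ok st; have inj := st_inj st.
have H c' d' : form (st_map (s := S) c') (st_map d') * (t (st_map c'))%:R = v%:R * (form c' d' * (t c')%:R).
  have en0 : (eps d')%:R != 0 :> rat by rewrite pnatr_eq0 -lt0n eps_gt0.
  apply: (mulIf en0); rewrite -mulrA -natrM -{1}He form_cartan // Hv natrM -mulrA.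
  by rewrite (st_cartan st) -form_cartan // natrM; ring.
have np g' (x y : node g') : x != y -> affine_ok g' -> form x y <= 0.
  move=> xy ok1; have [xy'|/nonadj_form0 ->//] := boolP (adjacent x y).
  exact/ltW/adjacent_form_lt0.
have [<-|cd] := eqVneq c d.
  by rewrite -!minnMr !natrM mulrA H; ring.
have mcd : st_map (s := S) c != st_map d by apply: contra cd => /eqP/inj ->.
(* Off the diagonal the form is nonpositive and turns the minimum into a maximum of two products,
   each covered by [H], one of them after exchanging [c] and [d]. *)
rewrite -!minEnat !natr_min (minr_nMr _ _ (np _ _ _ mcd ok)) (minr_nMr _ _ (np _ _ _ cd ok')).
rewrite maxr_pMr ?ler0n // !natrM; congr (Order.max _ _).
  by rewrite mulrA form_sym H form_sym; ring.
by rewrite mulrA H; ring.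
Qed.

(* The vertices are numbered so that every vertex other than 1 has exactly one smaller
   neighbour; this makes the diagram a tree rooted at 1. *)
Definition parent (X : dynkin) (j : nat) : nat :=
  match X with
  | FD n => if j == n then n - 2 else j.-1
  | FE6 => if j == 6 then 3 else j.-1
  | FE7 => if j == 7 then 3 else j.-1
  | FE8 => if j == 8 then 5 else j.-1
  | _ => j.-1
  end%N.

Definition up g : rel (node g) := fun x y => y.+1 == parent (circ g) x.+1.

Lemma edge_parent X n i j : dynkin_ok X n -> (0 < i <= n)%N -> (0 < j <= n)%N ->
  edge X i j = (i == parent X j).
Proof.
case: X => [m|m|m|m| | | |o|o] ok hi hj; rewrite /edge /parent; rewrite /dynkin_ok in ok.
all: try lia.
all: case: ifP; lia.
Qed.

Lemma parent_lt X n j : dynkin_ok X n -> (0 < j)%N -> (parent X j < j)%N.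
Proof.
case: X => [m|m|m|m| | | |o|o] ok hj; rewrite /parent; rewrite /dynkin_ok in ok.
all: try lia.
all: case: ifP; lia.
Qed.

Lemma parent_gt0 X n j : dynkin_ok X n -> (1 < j)%N -> (0 < parent X j)%N.
Proof.
case: X => [m|m|m|m| | | |o|o] ok hj; rewrite /parent; rewrite /dynkin_ok in ok.
all: try lia.
all: case: ifP; lia.
Qed.

Lemma adjacent_up g (x y : node g) : affine_ok g -> adjacent x y = up x y || up y x.
Proof.
move=> /circ_ok ok; have hx := ltn_ord x; have hy := ltn_ord y.
by rewrite /adjacent /adj /up !(edge_parent ok) // orbC.
Qed.

Lemma up_lt g (x y : node g) : affine_ok g -> up x y -> (y < x)%N.
Proof. by move=> /circ_ok ok /eqP e; have := parent_lt ok (ltn0Sn x); rewrite -e. Qed.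

Lemma up_inj g (x y z : node g) : up x y -> up x z -> y = z.
Proof. by rewrite /up => /eqP <- /eqP [/ord_inj]. Qed.

Lemma up_exists g (x : node g) : affine_ok g -> (0 < x)%N -> exists y, up x y.
Proof.
move=> /circ_ok ok x0; have p0 : (0 < parent (circ g) x.+1)%N by apply: parent_gt0 ok _.
have pl := parent_lt ok (ltn0Sn x); have xl := ltn_ord x.
have pn : ((parent (circ g) x.+1).-1 < rank g)%N by lia.
by exists (Ordinal pn); rewrite /up /= prednK.
Qed.

Lemma desc_ge g (x a : node g) : affine_ok g -> connect (@up g) x a -> (a <= x)%N.
Proof.
move=> ok /connectP [p ep ->]; elim: p x ep => //= y p IH x /andP[/(up_lt ok) yx /IH h].
exact: leq_trans h (ltnW yx).
Qed.

(** The only edge leaving the subtree below [a] joins [a] to its parent [b], and a path avoiding [b]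
    cannot use it. *)
Lemma desc_closed g (b a x y : node g) : affine_ok g -> up a b ->
  connect (@up g) x a -> connect (avoid b) x y -> connect (@up g) y a.
Proof.
move=> ok ab xa /connectP [p ep ->]; elim: p x xa ep => //= z p IH x xa /andP[xz].
apply: IH; have /and3P[ad xb zb] := xz.
move: ad; rewrite adjacent_up // => /orP[ux|uz]; last first.
  by rewrite (connect_trans _ xa) // connect1.
have [xa'|/(connect_first xa)[w xw]] := eqVneq x a.
  by move: zb; rewrite xa' in ux; rewrite (up_inj ux ab) eqxx.
by rewrite (up_inj ux xw).
Qed.

(** At most one neighbour of b is its parent, so of two different neighbours one is a child. Its
    component stays in its own subtree, which contains neither the parent of b nor another child of
    b. *)
Lemma component_inj g (b a a' c : node g) : affine_ok g -> adjacent a b -> adjacent a' b ->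
  c \in component b a -> c \in component b a' -> a = a'.
Proof.
move=> ok; rewrite !componentE.
have W x x' : up x b -> adjacent x' b -> connect (avoid b) x x' -> x = x'.
  move=> xb x'b xx'; have := desc_closed ok xb (connect0 _ x) xx' => h.
  apply/eqP/negPn/negP; rewrite eq_sym => ne.
  move: x'b; rewrite adjacent_up // => /orP[u|u].
    have [z /(up_inj u) <- /(desc_ge ok)] := connect_first h ne.
    by have := up_lt ok xb; lia.
  by have := desc_ge ok h; have := up_lt ok xb; have := up_lt ok u; lia.
move=> ab a'b ac a'c.
have aa' : connect (avoid b) a a' by rewrite (connect_trans ac) // avoid_connect_sym.
have := ab; rewrite adjacent_up // => /orP[u|u]; first exact: W.
have := a'b; rewrite adjacent_up // => /orP[u'|u']; last exact: up_inj u u'.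
by symmetry; apply: W => //; rewrite avoid_connect_sym.
Qed.

Lemma avoid_up g (b x y : node g) : affine_ok g -> up x y -> x != b -> y != b -> avoid b x y.
Proof. by move=> ok u xb yb; rewrite /avoid /= adjacent_up // u xb yb. Qed.

(** Climb from [c] towards the root. If [b] is met, the vertex just before it is the required child;
    otherwise the root is reached, and the parent of [b] reaches it too, because vertices numbered
    below [b] only climb to smaller ones. *)
Lemma component_exists g (b c : node g) : affine_ok g -> c != b ->
  exists2 a, adjacent a b & c \in component b a.
Proof.
move=> ok cb.
have below n (x z : node g) : (x < n)%N -> (x < b)%N -> z = 0 :> nat -> connect (avoid b) x z.
  elim: n x => // n IH x xn xb z0; have [x0|x0] := posnP x.
    by have -> : x = z by apply: ord_inj; rewrite x0 z0.
  have [y xy] := up_exists ok x0; have yx := up_lt ok xy.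
  have h : connect (avoid b) y z by apply: IH => //; lia.
  apply: connect_trans h; apply/connect1/avoid_up => //.
    by apply: contraTneq xb => ->; rewrite ltnn.
  by apply: contraTneq xb => <-; rewrite -leqNgt ltnW.
have key n (x : node g) : (x < n)%N -> x != b ->
    (exists2 a, adjacent a b & connect (avoid b) a x) \/
    (exists2 z : node g, z = 0 :> nat & z != b /\ connect (avoid b) z x).
  elim: n x => // n IH x xn xb; have [x0|x0] := posnP x; first by right; exists x.
  have [y xy] := up_exists ok x0; have yx := up_lt ok xy.
  have [yb|yb] := eqVneq y b; first by left; exists x => //; rewrite adjacent_up // -yb xy.
  have e : connect (avoid b) y x.
    by rewrite avoid_connect_sym; apply/connect1/avoid_up.
  have [|[a ab ay]|[z z0 [zb zy]]] := IH y _ yb; first lia.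
    by left; exists a; rewrite // (connect_trans ay).
  by right; exists z; rewrite // (connect_trans zy).
have [[a ab ac]|[z z0 [zb zc]]] := key c.+1 c (leqnn _) cb; first by exists a; rewrite // componentE.
have b0 : (0 < b)%N by rewrite lt0n; apply: contra zb => /eqP e; apply/eqP/ord_inj; rewrite z0 e.
have [y byy] := up_exists ok b0; exists y; first by rewrite adjacent_up // byy orbT.
by rewrite componentE (connect_trans _ zc) //; apply: (below y.+1) => //; apply: up_lt.
Qed.

(** * Finite sums *)

Lemma big_pos (R : Type) (idx : R) (op : Monoid.com_law idx) K (f : nat -> R) :
  (forall i, (K < i)%N -> f i = idx) ->
  \big[op/idx]_(i \in pos) f i = \big[op/idx]_(i < K) f i.+1.
Proof.
move=> H; rewrite -(big_mkord predT (fun i => f i.+1)) -(big_add1 _ _ 0 K.+1 predT f).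
have -> : pos = [set` [pred i | 0 < i]%N] by [].
rewrite -(bigfs op (r := index_iota 1 K.+1)) ?iota_uniq //.
  rewrite big_seq_cond [RHS]big_seq_cond; apply: eq_bigl => i.
  by rewrite mem_index_iota /=; lia.
by move=> i /= i0; rewrite mem_index_iota => n; apply: H; lia.
Qed.

Lemma sum_posE (V : nmodType) K (f : nat -> V) :
  (forall i, (K < i)%N -> f i = 0) -> sum_pos f = \sum_(i < K) f i.+1.
Proof. exact: big_pos. Qed.

Lemma prod_posE (F : fieldType) K (f : nat -> F) :
  (forall i, (K < i)%N -> f i = 1) -> prod_pos f = \prod_(i < K) f i.+1.
Proof. exact: big_pos. Qed.

Lemma fin_seq_bound f : fin_seq f -> exists K, forall i, (K < i)%N -> f i = 0%N.
Proof.
case=> _ /finite_seqP [s Hs]; exists (\max_(i <- s) i) => i si; apply/eqP/negPn/negP => fi.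
have : [set` s] i by rewrite -Hs.
by move=> /= is_; move: si; rewrite ltnNge (@leq_bigmax_seq nat s predT id i is_ isT).
Qed.

Lemma bound_fin_seq f K : f 0%N = 0%N -> (forall i, (K < i)%N -> f i = 0%N) -> fin_seq f.
Proof.
move=> f0 H; split=> //; apply: (@sub_finite_set _ _ [set` iota 0 K.+1]); last exact: finite_seq.
move=> i fi; change (i \in iota 0 K.+1); rewrite /= in fi.
by rewrite mem_iota leq0n ltnS; case: leqP => // /H e; rewrite e in fi.
Qed.

(** Injectivity is asked only on [B] because a configuration on D_a will be represented by a full
    configuration of g with prescribed values off D_a; without [B] the restriction map would not be
    injective. *)
Lemma fsum_inj (V : nmodType) (T : finType) (U : choiceType) (e : T -> U) (B : pred T)
    (A : set U) (F : U -> V) :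
  {in B &, injective e} -> (forall u, A u -> exists2 t, B t & e t = u) ->
  \sum_(u \in A) F u = \sum_(t | B t && `[< A (e t) >]) F (e t).
Proof.
move=> inj onto; set P : pred T := fun t => B t && `[< A (e t) >].
have AE : A = e @` [set` P].
  apply/seteqP; split=> [u Au|_ [t /andP[_ /asboolP At] <-] //].
  have [t Bt et] := onto u Au; exists t => //.
  by apply/andP; split=> //; apply/asboolP; rewrite et.
rewrite [in LHS]AE fsbig_image; last first.
  by move=> x y; rewrite !inE /= => /andP[Bx _] /andP[By _]; apply: inj.
by rewrite -(bigfs _ (r := index_enum T)) ?index_enum_uniq // => i _; rewrite mem_index_enum.
Qed.

(* A sequence (m_i)_{1 <= i <= K} with values at most K is encoded as a finite function, with m_i at
   index i - 1. *)
Section Embedding.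
Variable K : nat.
Notation T := {ffun 'I_K -> 'I_K.+1}.

Definition emb (u : T) (i : nat) : nat :=
  if i is j.+1 then oapp (fun j' : 'I_K => u j' : nat) 0%N (insub j) else 0%N.

Definition cut (f : nat -> nat) : T := [ffun j : 'I_K => inord (f j.+1)].

Lemma embS u (j : 'I_K) : emb u j.+1 = u j.
Proof. by rewrite /emb valK. Qed.

Lemma emb_out u i : (K < i)%N -> emb u i = 0%N.
Proof. by case: i => //= i Ki; rewrite insubF //; lia. Qed.

Lemma emb_inj : injective emb.
Proof. by move=> u v e; apply/ffunP => j; apply/val_inj; rewrite /= -!embS e. Qed.

Lemma emb_cut f : f 0%N = 0%N -> (forall i, (K < i)%N -> f i = 0%N) ->
  (forall i, f i <= K)%N -> emb (cut f) = f.
Proof.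
move=> f0 fo fK; apply/funext => -[|i] //; have [iK|iK] := ltnP i K.
  by rewrite (embS _ (Ordinal iK)) ffunE inordK // ltnS.
by rewrite emb_out ?fo.
Qed.

Lemma emb_fin u : fin_seq (emb u).
Proof. by apply: (@bound_fin_seq _ K) => // i; apply: emb_out. Qed.

Definition wt (u : T) : nat := (\sum_(j < K) j.+1 * u j)%N.

Lemma sum_pos_emb (V : nmodType) (u : T) (F : nat -> nat -> V) : (forall i, F i 0%N = 0) ->
  sum_pos (fun i => F i (emb u i)) = \sum_(j < K) F j.+1 (u j).
Proof.
move=> F0; rewrite (@sum_posE _ K) => [|i Ki]; last by rewrite emb_out.
by apply: eq_bigr => j _; rewrite embS.
Qed.

Lemma wtE u : sum_pos (fun i => i%:R * (emb u i)%:R) = (wt u)%:R :> rat.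
Proof.
rewrite (sum_pos_emb u (F := fun i n => i%:R * n%:R)) => [|i]; last by rewrite mulr0.
by rewrite natr_sum; apply: eq_bigr => j _; rewrite natrM.
Qed.

(** Every product i f_i is at most s <= K, which bounds the support and the values at once; this is
    why one K serves for both in the encoding. *)
Lemma weight_bound f s : fin_seq f -> sum_pos (fun i => i%:R * (f i)%:R) = s%:R :> rat ->
  (s <= K)%N -> emb (cut f) = f.
Proof.
move=> ff; have [f0 _] := ff; have [N fN] := fin_seq_bound ff.
rewrite (@sum_posE _ N) => [|i Ni]; last by rewrite fN ?mulr0.
move=> E sK; have {}E : (\sum_(j < N) j.+1 * f j.+1 = s)%N.
  by apply/eqP; rewrite -(eqr_nat rat) -E natr_sum; apply/eqP/eq_bigr => j _; rewrite natrM.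
have b i : (i * f i <= K)%N.
  have [iN|iN] := leqP i N; last by rewrite fN // muln0.
  case: i iN => // i iN; rewrite (leq_trans _ sK) // -E (bigD1 (Ordinal iN)) //=.
  exact: leq_addr.
apply: emb_cut => // i.
  by move=> Ki; have := b i; case: (f i) => // n; rewrite mulnS; lia.
by case: i => [|i]; rewrite ?f0 //; have := b i.+1; rewrite mulSn; lia.
Qed.

End Embedding.

(* The configurations on D a are those equal to [m0] off D a; each factor may also depend on the common
   values of [m0] outside all the D a. *)
Lemma prod_sum_glue (R : comPzSemiRingType) (I J T : finType) (m0 : {ffun I -> T}) (P : pred J)
    (D : J -> {set I}) (C : J -> pred {ffun I -> T}) (w : J -> {ffun I -> T} -> R) :
  (forall a a' i, P a -> P a' -> i \in D a -> i \in D a' -> a = a') ->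
  (forall a (m m' : {ffun I -> T}), P a -> (forall i, (i \in D a) || [forall (a' | P a'), i \notin D a'] ->
       m i = m' i) ->
     C a m = C a m' /\ w a m = w a m') ->
  \prod_(a | P a) \sum_(m : {ffun I -> T} | [forall (i | i \notin D a), m i == m0 i] && C a m) w a m =
  \sum_(m : {ffun I -> T} | [forall (i | [forall (a | P a), i \notin D a]), m i == m0 i] && [forall (a | P a), C a m])
     \prod_(a | P a) w a m.
Proof.
move=> Dinj loc.
(* The product expands into a sum over families f of configurations. [glue] takes f a on D a, and
   [restr] recovers f a from the result since f a agrees with [m0] elsewhere; for indices outside
   [P] the family has the default value [m0]. *)
rewrite (big_distr_big_dep m0).
pose restr a (m : {ffun I -> T}) : {ffun I -> T} := [ffun i => if i \in D a then m i else m0 i].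
pose h (m : {ffun I -> T}) : {ffun J -> {ffun I -> T}} := [ffun a => if P a then restr a m else m0].
pose glue (f : {ffun J -> {ffun I -> T}}) : {ffun I -> T} :=
  [ffun i => if [pick a | P a && (i \in D a)] is Some a then f a i else m0 i].
have glueE f a i : P a -> i \in D a -> glue f i = f a i.
  move=> Pa ia; rewrite ffunE; case: pickP => [a' /andP[Pa' ia']|/(_ a)]; last by rewrite Pa ia.
  by rewrite (Dinj _ _ _ Pa Pa' ia ia').
have glueO f i : [forall (a | P a), i \notin D a] -> glue f i = m0 i.
  move=> /'forall_implyP H; rewrite ffunE; case: pickP => // a /andP[Pa ia].
  by have := H a Pa; rewrite ia.
have restrL a (m m1 : {ffun I -> T}) : P a -> (forall i, i \in D a -> m1 i = m i) ->
   (forall i, [forall (a | P a), i \notin D a] -> m1 i = m i) ->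
   C a m1 = C a m /\ w a m1 = w a m.
  by move=> Pa H1 H2; apply: loc => // i /orP[/H1|/H2].
rewrite (reindex_onto h glue) /=; last first.
  move=> f /pfamilyP [fs fQ]; apply/ffunP => a; rewrite ffunE; case: ifP => [Pa|nPa].
    have /andP[/'forall_implyP fa _] := fQ a Pa.
    apply/ffunP => i; rewrite ffunE; case: ifP => [ia|/negbT ia]; first exact: glueE.
    by rewrite (eqP (fa i ia)).
  have [->//|ne] := eqVneq (f a) m0.
  by have := fintype.subsetP fs a; rewrite !inE /= ne => /(_ isT); rewrite unfold_in nPa.
apply: eq_big => [m|m].
  apply/andP/andP => [[/pfamilyP [_ hQ] /eqP gm]|[/'forall_implyP mO /'forall_implyP mC]].
    have mO i : [forall (a | P a), i \notin D a] -> m i = m0 i by move=> iO; rewrite -gm glueO.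
    split; first by apply/'forall_implyP => i /mO ->.
    apply/'forall_implyP => a Pa; have /andP[_] := hQ a Pa; rewrite ffunE Pa.
    have [||<- _] // := restrL a m (restr a m) Pa.
    - by move=> i ia; rewrite ffunE ia.
    - by move=> i iO; rewrite ffunE mO //; case: ifP => // _; exact: mO.
  split.
    apply/pfamilyP; split.
      apply/fintype.subsetP => a; rewrite inE /= ffunE; case: ifP => //; by rewrite eqxx.
    move=> a aP; have Pa : P a by []; rewrite unfold_in /= ffunE Pa; apply/andP; split.
      by apply/'forall_implyP => i /negPf ia; rewrite ffunE ia.
    have [||-> _] := restrL a m (restr a m) Pa; last exact: mC.
    - by move=> i ia; rewrite ffunE ia.
    - by move=> i iO; rewrite ffunE (eqP (mO i iO)); case: ifP.
  apply/eqP/ffunP => i; have [iO|] := boolP [forall (a | P a), i \notin D a].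
    by rewrite glueO // (eqP (mO i iO)).
  rewrite negb_forall => /existsP [a]; rewrite negb_imply negbK => /andP[Pa ia].
  by rewrite (glueE _ a) // ffunE Pa ffunE ia.
case/andP => _ /eqP gm; apply: eq_bigr => a Pa; rewrite ffunE Pa.
have [||] // := restrL a m (restr a m) Pa.
- by move=> i ia; rewrite ffunE ia.
- by move=> i iO; rewrite ffunE -gm glueO //; case: ifP.
Qed.

(** * Charges and vacancy numbers *)

Definition kern g (c d : node g) (i k : nat) : rat :=
  form c d * (minn (t d * i) (t c * k))%:R.

Definition ufill (nu : nat -> nat) (i : nat) : rat :=
  sum_pos (fun j => (nu j)%:R * (minn i j)%:R).

Section Field.
Variable K : nat.
Notation T := {ffun 'I_K -> 'I_K.+1}.

(** This is tv_c times the amount by which the content [u] of the node [d] lowers p_i^(c). *)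
Definition pull g (c d : node g) (u : T) (i : nat) : rat :=
  \sum_(k < K) kern c d i k.+1 * (u k)%:R.

Definition energy g (c d : node g) (u v : T) : rat :=
  \sum_(j < K) (u j)%:R * pull c d v j.+1.

Lemma sum_pos0 (V : nmodType) (f : nat -> V) : (forall i, f i = 0) -> sum_pos f = 0.
Proof. by move=> f0; rewrite (@sum_posE _ 0) ?big_ord0. Qed.

Lemma vacancy_emb g (a : node g) nu (m : node g -> T) c i :
  vacancy (at_node a nu) (fun c => emb (m c)) c i =
  (if c == a then ufill nu i else 0) - (tv c)%:R^-1 * \sum_d pull c d (m d) i.
Proof.
rewrite /vacancy /at_node; congr (_ - _ * _).
  by case: eqP => // _; apply: sum_pos0 => j; rewrite mul0r.
apply: eq_bigr => d _; rewrite (sum_pos_emb (m d) (F := fun k n => kern c d i k * n%:R)) //.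
by move=> k; rewrite mulr0.
Qed.

Lemma charge_emb g (a : node g) nu (m : node g -> T) : fin_seq nu ->
  charge (at_node a nu) (fun c => emb (m c)) =
  2^-1 * (\sum_c \sum_d energy c d (m c) (m d))
  - (tv a)%:R * \sum_(k < K) (m a k)%:R * ufill nu k.+1.
Proof.
move=> /fin_seq_bound [N nuN]; rewrite /charge /at_node; congr (_ * _ - _).
  apply: eq_bigr => c _; apply: eq_bigr => d _.
  rewrite (sum_pos_emb (m c) (F := fun j n => sum_pos (fun k => kern c d j k * n%:R * (emb (m d) k)%:R))).
    apply: eq_bigr => j _.
    rewrite (sum_pos_emb (m d) (F := fun k n => kern c d j.+1 k * (m c j)%:R * n%:R)) => [|k].
      by rewrite /pull mulr_sumr; apply: eq_bigr => k _; ring.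
    by rewrite mulr0.
  by move=> j; apply: sum_pos0 => k; rewrite mulr0 mul0r.
rewrite (bigD1 a) //= big1 ?addr0 => [|c /negPf ->]; last first.
  by rewrite sum_pos0 ?mulr0 // => j; apply: sum_pos0 => k; rewrite mulr0 mul0r.
congr (_ * _); rewrite (@sum_posE _ N) => [|j Nj]; last first.
  by apply: sum_pos0 => k; rewrite eqxx nuN // mulr0 mul0r.
transitivity (\sum_(j < N) \sum_(k < K) (minn j.+1 k.+1)%:R * (nu j.+1)%:R * (m a k)%:R : rat).
  apply: eq_bigr => j _.
  rewrite (sum_pos_emb (m a) (F := fun k n => (minn j.+1 k)%:R * (if a == a then nu j.+1 else 0%N)%:R * n%:R : rat)) ?eqxx //.
  by move=> k; rewrite mulr0.
rewrite exchange_big; apply: eq_bigr => k _; rewrite /ufill (@sum_posE _ N) => [|j Nj]; last first.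
  by rewrite nuN // mul0r.
by rewrite mulr_sumr; apply: eq_bigr => j _; rewrite (minnC j.+1); ring.
Qed.

Lemma kern_sym g (c d : node g) i k : kern c d i k = kern d c k i.
Proof. by rewrite /kern form_sym minnC. Qed.

Lemma energy_sym g (c d : node g) u v : energy c d u v = energy d c v u.
Proof.
rewrite /energy; under eq_bigr do rewrite mulr_sumr.
rewrite exchange_big; apply: eq_bigr => k _; rewrite mulr_sumr; apply: eq_bigr => j _.
by rewrite kern_sym; ring.
Qed.

Lemma pull_int g (c d : node g) u i : affine_ok g -> (tv c)%:R^-1 * pull c d u i \is a Num.int.
Proof.
move=> ok; rewrite mulr_sumr; apply: rpred_sum => k _.
by rewrite mulrA rpredM ?rpred_nat // mulrC kernel_int.
Qed.

Lemma energy_int g (c d : node g) u v : affine_ok g -> energy c d u v \is a Num.int.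
Proof.
move=> ok; apply: rpred_sum => j _; rewrite rpredM ?rpred_nat //.
have vn0 : (tv c)%:R != 0 :> rat by rewrite pnatr_eq0 -lt0n tv_gt0.
by rewrite -[pull _ _ _ _](mulVKf vn0) rpredM ?rpred_nat // pull_int.
Qed.

(** The factor 2 makes the halved quadratic form integral; at the node b, tv / eps is the origin of
    the coefficient of psi. *)
Lemma kern_diag g (c : node g) i k : affine_ok g ->
  kern c c i k = 2 * ((tv c %/ eps c) * minn i k)%:R.
Proof.
move=> ok; have en0 : (eps c)%:R != 0 :> rat by rewrite pnatr_eq0 -lt0n eps_gt0.
apply: (mulIf en0); rewrite /kern -minnMr natrM.
have -> : form c c * ((t c)%:R * (minn i k)%:R) * (eps c)%:R =
  form c c * (t c * eps c)%:R * (minn i k)%:R by rewrite natrM; ring.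
rewrite form_diag // -{1}(divnK (eps_dvd_tv c ok)) !natrM.
by ring.
Qed.

Lemma half_energy_diag_int g (c : node g) u : affine_ok g -> 2^-1 * energy c c u u \is a Num.int.
Proof.
move=> ok; rewrite mulr_sumr; apply: rpred_sum => j _.
rewrite mulrCA rpredM ?rpred_nat // mulr_sumr; apply: rpred_sum => k _.
by rewrite kern_diag // !mulrA mulVf // mul1r rpredM ?rpred_nat.
Qed.

Lemma half_sum_int n (A : pred 'I_n) (X : 'I_n -> 'I_n -> rat) : (forall i j, X i j = X j i) ->
  (forall i j, X i j \is a Num.int) -> (forall i, 2^-1 * X i i \is a Num.int) ->
  2^-1 * (\sum_(i | A i) \sum_(j | A j) X i j) \is a Num.int.
Proof.
move=> Xs Xi Xd; pose B (j i : 'I_n) := if (j < i)%N then X i j else 0.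
have E i j : X i j = (if i == j then X i i else 0) + B j i + B i j.
  rewrite /B; have [->|ij] := eqVneq i j; first by rewrite ltnn !addr0.
  by case: ltngtP => [_|_|/ord_inj e]; [rewrite addr0 add0r|rewrite !add0r Xs|rewrite e eqxx in ij].
have -> : \sum_(i | A i) \sum_(j | A j) X i j =
   \sum_(i | A i) X i i + 2 * \sum_(i | A i) \sum_(j | A j) B j i.
  transitivity (\sum_(i | A i) (X i i + \sum_(j | A j) B j i + \sum_(j | A j) B i j)).
    apply: eq_bigr => i Ai; under eq_bigr => j Aj do rewrite E.
    rewrite !big_split /=; congr (_ + _ + _).
    by rewrite -big_mkcondr (big_pred1 i) // => j /=; rewrite andbC; case: eqVneq => // <-.
  rewrite !big_split /= [X in _ + _ + X]exchange_big /= -addrA; congr (_ + _).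
  by rewrite mulrDl !mul1r.
rewrite mulrDr rpredD //.
  by rewrite mulr_sumr rpred_sum.
rewrite mulrA mulVf // mul1r; apply: rpred_sum => i _; apply: rpred_sum => j _.
by rewrite /B; case: ifP => _; rewrite ?rpred0.
Qed.

Lemma half_energy_int g (A : pred (node g)) (m : node g -> T) : affine_ok g ->
  2^-1 * (\sum_(c | A c) \sum_(d | A d) energy c d (m c) (m d)) \is a Num.int.
Proof.
move=> ok; apply: (half_sum_int _ (X := fun c d => energy c d (m c) (m d))) => [c d|c d|c].
- exact: energy_sym.
- exact: energy_int.
- exact: half_energy_diag_int.
Qed.

End Field.

(** Summation by parts: min(i, j) inverts minus the second difference. The last term is the boundary
    contribution of stopping at N. *)
Lemma second_difference_sum (f : nat -> rat) (i N : nat) : f 0%N = 0 ->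
  \sum_(j < N) (minn i j.+1)%:R * (2 * f j.+1 - f j.+2 - f j) =
  f (minn i N) - (minn i N)%:R * (f N.+1 - f N).
Proof.
move=> f0; elim: N => [|N IH]; first by rewrite big_ord0 minn0 f0 mul0r subrr.
rewrite big_ord_recr /= IH; have [iN|Ni] := leqP i N.
  by rewrite (minn_idPl (leqW iN)); ring.
by rewrite (minn_idPr Ni) (_ : N.+1%:R = N%:R + 1) ?natr1 //; ring.
Qed.

Section Star.
Variable K : nat.
Notation T := {ffun 'I_K -> 'I_K.+1}.

Lemma Bcoef_ge0 g (a b : node g) k j : (0 < j)%N -> (0 <= Bcoef b k a j)%R.
Proof. by rewrite /Bcoef => j0; nia. Qed.

(** The truncation in [nu_star] loses nothing: the form is negative on an edge and [Bcoef] is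
    nonnegative by concavity of j |-> min(t_a k, t_b j), while integrality is that of the kernel. *)
Lemma nu_star_nat g (a b : node g) (u : T) j : affine_ok g -> adjacent a b ->
  (nu_star b a (emb u) j.+1)%:R =
  - (form a b / (tv a)%:R) * \sum_(k < K) (u k)%:R * (Bcoef b k.+1 a j.+1)%:~R :> rat.
Proof.
move=> ok ab; rewrite /nu_star.
rewrite (sum_pos_emb u (F := fun k n => n%:R * (Bcoef b k a j.+1)%:~R : rat)) => [|k]; last by rewrite mul0r.
rewrite truncnK // natrEint; apply/andP; split; last first.
  rewrite mulr_ge0 //.
    by rewrite oppr_ge0 pmulr_lle0 ?invr_gt0 ?ltr0n ?tv_gt0 // ltW ?adjacent_form_lt0.
  by apply: sumr_ge0 => k _; rewrite mulr_ge0 ?ler0n // ler0z Bcoef_ge0.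
rewrite mulNr rpredN mulr_sumr; apply: rpred_sum => k _.
rewrite mulrCA rpredM ?rpred_nat // /Bcoef !rmorphB rmorphM /= -!pmulrn.
have H i : form a b / (tv a)%:R * (minn (t a * k.+1) (t b * i))%:R \is a Num.int.
  by rewrite mulrAC minnC kernel_int.
by rewrite !mulrBr mulrCA !rpredB // rpredM // rpred_nat.
Qed.

Lemma nu_star_fin g (a b : node g) (u : T) : affine_ok g ->
  forall j, (t a * K < j)%N -> nu_star b a (emb u) j = 0%N.
Proof.
move=> ok [//|j] Kj; rewrite /nu_star.
rewrite (sum_pos_emb u (F := fun k n => n%:R * (Bcoef b k a j.+1)%:~R : rat)) => [|k]; last by rewrite mul0r.
rewrite big1 ?mulr0 ?truncn0 // => k _.
(* Beyond t_a K all three minima in [Bcoef] equal t_a k and cancel. *)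
have tk : (t a * k.+1 <= t b * j)%N.
  have := t_gt0 b ok; have : (t a * k.+1 <= t a * K)%N by rewrite leq_mul2l ltn_ord orbT.
  by nia.
rewrite /Bcoef /= !(minn_idPl _) //; first by rewrite (_ : _ - _ = 0) ?mulr0 //; lia.
- by rewrite (leq_trans tk) // leq_mul2l; lia.
- by rewrite (leq_trans tk) // leq_mul2l; lia.
Qed.

Lemma nu_star_fin_seq g (a b : node g) (u : T) : affine_ok g -> fin_seq (nu_star b a (emb u)).
Proof. by move=> ok; apply: (@bound_fin_seq _ (t a * K)) => //; apply: nu_star_fin. Qed.

Lemma ufill_nu_star g (a b : node g) (u : T) i : affine_ok g -> adjacent a b ->
  ufill (nu_star b a (emb u)) i = - ((tv a)%:R^-1 * pull a b u i).
Proof.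
move=> ok ab; rewrite /ufill (@sum_posE _ (t a * K)) => [|j Kj]; last by rewrite nu_star_fin ?mul0r.
under eq_bigr => j _.
  rewrite nu_star_nat // -mulrA mulr_suml; over.
rewrite -mulr_sumr exchange_big /=.
rewrite mulNr -mulrA; congr (- _); rewrite mulrCA; congr (_ * _); rewrite /pull mulr_sumr.
apply: eq_bigr => k _; rewrite /kern -mulrA [_%:R * (u k)%:R]mulrC; congr (_ * _).
under eq_bigr => j _ do rewrite -mulrA; rewrite -mulr_sumr; congr (_ * _).
pose f j : rat := (minn (t a * k.+1) (t b * j))%:R.
transitivity (\sum_(j < t a * K) (minn i j.+1)%:R * (2 * f j.+1 - f j.+2 - f j)).
  apply: eq_bigr => j _; rewrite mulrC /Bcoef !rmorphB rmorphM /= -!pmulrn; congr (_ * _).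
rewrite second_difference_sum /f ?muln0 ?minn0 //.
(* From N = t_a K on, [f] is constant, so the boundary term of the summation by parts vanishes. *)
have bk j : (t a * K <= j)%N -> (t a * k.+1 <= t b * j)%N.
  have := t_gt0 b ok; have : (t a * k.+1 <= t a * K)%N by rewrite leq_mul2l ltn_ord orbT.
  by nia.
rewrite (minn_idPl (bk _ (leqnSn _))) (minn_idPl (bk _ (leqnn _))) subrr mulr0 subr0 minnC; congr (_%:R).
have [iN|Ni] := leqP i (t a * K); first by [].
by rewrite (minn_idPr (bk _ (leqnn _))) (minn_idPr (bk _ (ltnW Ni))).
Qed.

End Star.

(** * Admissible configurations and the inversion of q *)

Lemma admissible_at g (a : node g) nu (x : node g -> rat) (m : node g -> nat -> nat) :
  affine_ok g ->
  admissible (at_node a nu)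
    (sum_pos (fun j => j%:R * (nu j)%:R) *: Lam a - \sum_(c : node g) x c *: alpha c) m <->
  [/\ forall c, fin_seq (m c), forall c i, (0 < i)%N -> 0 <= vacancy (at_node a nu) m c i
    & forall c, sum_pos (fun i => i%:R * (m c i)%:R) = (eps c)%:R * x c].
Proof.
move=> ok; rewrite /admissible.
have -> : \sum_(c : node g) sum_pos (fun i => i%:R * (at_node a nu c i)%:R) *: Lam c =
  sum_pos (fun j => j%:R * (nu j)%:R) *: Lam a.
  rewrite (bigD1 a) //= [X in _ + X]big1 => [|c /negPf ca].
    by rewrite addr0 /at_node eqxx.
  by rewrite /at_node ca sum_pos0 ?scale0r // => i; rewrite mulr0.
rewrite opprB addrCA subrr addr0.
by split=> -[H1 H2 H3]; split=> //; apply/weight_eq.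
Qed.

Lemma qbinV (F : fieldType) (x : F) p m : x != 0 -> qbin x^-1 p m = x ^- (p * m) * qbin x p m.
Proof.
move=> x0; have H i : 1 - x^-1 ^+ i = - (x ^- i * (1 - x ^+ i)).
  by rewrite exprVn mulrBr mulr1 mulVf ?expf_neq0 // opprB.
have E i : (1 - x^-1 ^+ (p + i)) / (1 - x^-1 ^+ i) = x ^- p * ((1 - x ^+ (p + i)) / (1 - x ^+ i)).
  rewrite !H invrN mulrNN invfM mulrACA; congr (_ * _).
  by rewrite exprD invfM invrK mulfVK // expf_neq0.
rewrite /qbin; under eq_bigr => i _ do rewrite E.
by rewrite big_split /= prodr_const_nat subn1 /= exprVn -exprM.
Qed.

Lemma qbin0 (F : fieldType) (x : F) p : qbin x p 0 = 1.
Proof. by rewrite /qbin big_nil. Qed.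

Lemma ufill_int nu i : fin_seq nu -> ufill nu i \is a Num.int.
Proof.
move=> /fin_seq_bound [N nuN]; rewrite /ufill (@sum_posE _ N) => [|j Nj]; last by rewrite nuN // mul0r.
by apply: rpred_sum => j _; rewrite rpredM ?rpred_nat.
Qed.

Section Finite.
Variable K : nat.
Notation T := {ffun 'I_K -> 'I_K.+1}.

Lemma vacancy_int g (a : node g) nu (m : node g -> T) c i : affine_ok g -> fin_seq nu ->
  vacancy (at_node a nu) (fun c => emb (m c)) c i \is a Num.int.
Proof.
move=> ok fnu; rewrite vacancy_emb rpredB //; first by case: ifP; rewrite ?ufill_int ?rpred0.
by rewrite mulr_sumr rpred_sum // => d _; apply: pull_int.
Qed.

Lemma charge_int g (a : node g) nu (m : node g -> T) : affine_ok g -> fin_seq nu ->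
  charge (at_node a nu) (fun c => emb (m c)) \is a Num.int.
Proof.
move=> ok fnu; rewrite charge_emb // rpredB ?half_energy_int //.
rewrite rpredM ?rpred_nat // rpred_sum // => k _.
by rewrite rpredM ?rpred_nat ?ufill_int.
Qed.

Lemma prod_pos_emb (F : fieldType) (u : T) (f : nat -> nat -> F) : (forall i, f i 0%N = 1) ->
  prod_pos (fun i => f i (emb u i)) = \prod_(j < K) f j.+1 (u j).
Proof.
move=> f1; rewrite (@prod_posE _ K) => [|i Ki]; last by rewrite emb_out.
by apply: eq_bigr => j _; rewrite embS.
Qed.

Definition qpart (F : fieldType) (q : F) g (V : node g -> nat -> rat) (m : node g -> T) (c : node g) : F :=
  \prod_(j < K) qbin (q ^+ tv c) (Num.truncn (V c j.+1)) (m c j).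

(* Under q -> 1/q the binomial [p + m, m] acquires the factor q^(-pm); the sum of the t_c p m
   contributes twice the quadratic part of the charge with opposite sign and cancels the linear part. *)
Lemma term_inverse (F : fieldType) (q : F) g (b : node g) nu (m : node g -> T) :
  q != 0 -> affine_ok g -> fin_seq nu ->
  let V := vacancy (at_node b nu) (fun c => emb (m c)) in
  (forall c i, (0 < i)%N -> 0 <= V c i) ->
  q^-1 ^ Num.floor (charge (at_node b nu) (fun c => emb (m c))) *
    \prod_c prod_pos (fun i => qbin (q^-1 ^+ tv c) (Num.truncn (V c i)) (emb (m c) i)) =
  q ^ Num.floor (2^-1 * \sum_c \sum_d energy c d (m c) (m d)) * \prod_c qpart q V m c.
Proof.
move=> q0 ok fnu V V0.
pose z : nat := (\sum_c \sum_(j < K) tv c * Num.truncn (V c j.+1) * m c j)%N.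
have -> : \prod_c prod_pos (fun i => qbin (q^-1 ^+ tv c) (Num.truncn (V c i)) (emb (m c) i)) =
    q ^- z * \prod_c qpart q V m c.
  rewrite /z -prodrXr -prodfV -big_split; apply: eq_bigr => c _ /=.
  rewrite (prod_pos_emb (m c) (f := fun i n => qbin (q^-1 ^+ tv c) (Num.truncn (V c i)) n)) => [|i]; last exact: qbin0.
  rewrite /qpart -prodrXr -prodfV -big_split; apply: eq_bigr => j _ /=.
  by rewrite exprVn qbinV ?expf_neq0 // -exprM mulnA.
rewrite mulrA; congr (_ * _).
have -> : q ^- z = q^-1 ^ z%:Z by rewrite -exprnP exprVn.
rewrite -expfzDr ?invr_eq0 // exprz_inv; congr (_ ^ _).
apply: (@intr_inj rat); rewrite rmorphN rmorphD /= !floorK ?charge_int ?half_energy_int //.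
rewrite charge_emb //.
have -> : z%:Z%:~R = (tv b)%:R * (\sum_(k < K) (m b k)%:R * ufill nu k.+1)
   - \sum_c \sum_d energy c d (m c) (m d) :> rat.
  rewrite /z -pmulrn natr_sum.
  have E c : (\sum_(j < K) tv c * Num.truncn (V c j.+1) * m c j)%:R =
     (tv c)%:R * (\sum_(j < K) (m c j)%:R * (if c == b then ufill nu j.+1 else 0))
     - \sum_d energy c d (m c) (m d) :> rat.
    rewrite natr_sum mulr_sumr /energy exchange_big /= -sumrB; apply: eq_bigr => j _.
    rewrite !natrM truncnK; last by rewrite natrEint vacancy_int //= V0.
    have vn0 : (tv c)%:R != 0 :> rat by rewrite pnatr_eq0 -lt0n tv_gt0.
    by rewrite /V vacancy_emb -mulr_sumr; field.
  under eq_bigr => c _ do rewrite E.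
  rewrite sumrB; congr (_ - _); rewrite (bigD1 b) //= [X in _ + X]big1 ?addr0 ?eqxx // => c /negPf cb.
  by rewrite cb big1 ?mulr0 // => j _; rewrite mulr0.
by field.
Qed.

End Finite.

Section FiniteSums.
Variable K : nat.
Notation T := {ffun 'I_K -> 'I_K.+1}.

(* The vacancy numbers for nu = 0, and for L copies of W_l at the node b. *)
Definition vac0 g (m : node g -> T) (c : node g) (i : nat) : rat :=
  - ((tv c)%:R^-1 * \sum_d pull c d (m d) i).

Lemma sum_pos_single (V : nmodType) l (f : nat -> V) : (0 < l)%N -> (forall j, j != l -> f j = 0) ->
  sum_pos f = f l.
Proof.
case: l => // l _ f0; rewrite (@sum_posE _ l.+1) => [|j lj]; last by rewrite f0 //; lia.
rewrite (bigD1 ord_max) //= big1 ?addr0 // => i; rewrite -val_eqE /= => il; exact: f0.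
Qed.

Definition lvac g (b : node g) (l L : nat) (m : node g -> T) (c : node g) (i : nat) : rat :=
  (if c == b then (L * minn i l)%:R else 0) + vac0 m c i.

(** The bound K depends only on the weights and not on L, so one finite index type serves all L;
    this makes a termwise limit possible. *)
Lemma M_inftyV_finite (F : fieldType) (q : F) g (b : node g) (l L : nat) (mu : node g -> rat)
    (s : node g -> nat) :
  q != 0 -> affine_ok g -> (0 < l)%N -> (forall c, (eps c)%:R * mu c = (s c)%:R) ->
  (forall c, s c <= K)%N ->
  M_infty (at_node b (fun j => if j == l then L else 0%N))
    ((L * l)%:R *: Lam b - \sum_(c : node g) mu c *: alpha c) q^-1 =
  \sum_(m : {ffun node g -> T} | [forall c, wt (m c) == s c] &&
      `[< forall c i, (0 < i)%N -> 0 <= lvac b l L m c i >])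
    q ^ Num.floor (2^-1 * \sum_c \sum_d energy c d (m c) (m d)) * \prod_c qpart q (lvac b l L m) m c.
Proof.
move=> q0 ok l0 smu sK; set nu := fun j => _.
have fnu : fin_seq nu.
  by apply: (@bound_fin_seq _ l) => [|i li]; rewrite /nu; case: eqP => // e; lia.
have nuW : (L * l)%:R = sum_pos (fun j => j%:R * (nu j)%:R) :> rat.
  rewrite (@sum_pos_single _ l) // => [|j /negPf jl]; last by rewrite /nu jl mulr0.
  by rewrite /nu eqxx -natrM mulnC.
have vacE (m : {ffun node g -> T}) :
    vacancy (at_node b nu) (fun c => emb (m c)) = lvac b l L m.
  apply/funext => c; apply/funext => i; rewrite vacancy_emb; congr (_ + _); case: eqP => // _.
  rewrite /ufill (@sum_pos_single _ l) // => [|j /negPf jl]; last by rewrite /nu jl mul0r.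
  by rewrite /nu eqxx natrM.
rewrite nuW /M_infty.
rewrite (fsum_inj (e := fun m : {ffun node g -> T} => fun c => emb (m c)) (B := xpredT)).
- apply: eq_big => [m|m].
    rewrite /=; apply/asboolP/andP.
      move/(admissible_at _ _ _ _ ok) => [_ H2 H3]; split.
        apply/forallP => c; rewrite -(eqr_nat rat) -smu -H3 wtE; exact: eqxx.
      by apply/asboolP; rewrite -vacE.
    move=> [/forallP H1 /asboolP H2]; apply/(admissible_at _ _ _ _ ok); split=> [c||c].
    - exact: emb_fin.
    - by rewrite vacE.
    - by rewrite wtE (eqP (H1 c)) smu.
  case/andP => _ /asboolP /(admissible_at _ _ _ _ ok) [_ H2 _].
  by rewrite term_inverse // vacE.
- move=> m m' _ _ e; apply/ffunP => c; apply: emb_inj.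
  exact: (congr1 (fun f : node g -> nat -> nat => f c) e).
- move=> f /(admissible_at _ _ _ _ ok) [H1 _ H3].
  exists [ffun c => cut K (f c)] => //; apply/funext => c; rewrite ffunE.
  by apply: weight_bound (H1 c) _ (sK c); rewrite H3 smu.
Qed.

End FiniteSums.

(** * The fermionic form of g^* *)

Section Star.
Variable K : nat.
Notation T := {ffun 'I_K -> 'I_K.+1}.

Lemma pull0 g (c d : node g) i : pull c d ([ffun=> ord0] : T) i = 0.
Proof. by rewrite /pull big1 // => k _; rewrite ffunE mulr0. Qed.

Lemma pull_far g (c d : node g) (u : T) i : c != d -> ~~ adjacent c d -> pull c d u i = 0.
Proof.
by move=> cd ncd; rewrite /pull big1 // => k _; rewrite /kern nonadj_form0 // !mul0r.
Qed.

Lemma energy_far g (c d : node g) (u v : T) : c != d -> ~~ adjacent c d -> energy c d u v = 0.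
Proof. by move=> cd ncd; rewrite /energy big1 // => j _; rewrite pull_far // mulr0. Qed.

(** Consequently b acts on D_a through the node a alone, which is why the symbol of g^* is
    concentrated at a^*. *)
Lemma component_adjacent g (b a c : node g) : affine_ok g -> adjacent a b ->
  c \in component b a -> adjacent c b -> c = a.
Proof.
by move=> ok ab ca cb; apply: (component_inj ok cb ab _ ca); rewrite componentE connect0.
Qed.

Lemma star_component g (b a : node g) S : is_star b a S ->
  component b a = [set st_map (s := S) d | d in [set: node (st_alg S)]%SET]%SET.
Proof.
move=> st; apply/finset.setP => c; apply/idP/imsetP => [/(st_image st)[d <-]|[d _ ->]].
  by exists d; rewrite ?finset.in_setT.
by apply/(st_image st); exists d.
Qed.

Lemma big_star (R : Type) (idx : R) (op : Monoid.com_law idx) g (b a : node g) S (F : node g -> R) :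
  is_star b a S ->
  \big[op/idx]_(c in component b a) F c = \big[op/idx]_d F (st_map (s := S) d).
Proof.
move=> st; rewrite (star_component st) big_imset /=; last by move=> x y _ _; apply: (st_inj st).
by apply: eq_bigl => d; rewrite finset.in_setT.
Qed.

(* The part of the quadratic form involving D_a, including its interaction with the node b. *)
Definition comp_energy g (b a : node g) (m : node g -> T) : rat :=
  2^-1 * (\sum_(c in component b a) \sum_(d in component b a) energy c d (m c) (m d))
  + \sum_(c in component b a) energy c b (m c) (m b).

(** With these values prescribed off D_a, the sums for all the g^* range over configurations of g,
    as the gluing lemma requires. *)
Definition background g (b : node g) (u : T) : {ffun node g -> T} :=
  [ffun c => if c == b then u else [ffun=> ord0]].

Lemma comp_energy_int g (b a : node g) (m : node g -> T) : affine_ok g ->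
  comp_energy b a m \is a Num.int.
Proof.
move=> ok; rewrite rpredD ?half_energy_int //; apply: rpred_sum => c _; exact: energy_int.
Qed.

(** The charge of g^* multiplied by v is [comp_energy]: the quadratic parts match by the scaling of
    the kernel, and by [ufill_nu_star] the linear term in nu^* is the interaction energy of a with
    b. Taking q^* = q^v absorbs v. *)
Lemma calM_finite (F : fieldType) (q : F) g (b a : node g) S (mu : node g -> rat)
    (s : node g -> nat) (u : T) :
  q != 0 -> affine_ok g -> adjacent a b -> is_star b a S ->
  (forall c, (eps c)%:R * mu c = (s c)%:R) -> (forall c, s c <= K)%N ->
  calM (st_node S) (nu_star b a (emb u)) (mu_star mu S) (q_star q a S) =
  \sum_(m : {ffun node g -> T} | [forall (c | c \notin component b a), m c == background b u c] &&
      [forall (c | c \in component b a),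
        (wt (m c) == s c) && `[< forall i, (0 < i)%N -> 0 <= vac0 m c i >]])
    q ^ Num.floor (comp_energy b a m) * \prod_(c in component b a) qpart q (vac0 m) m c.
Proof.
move=> q0 ok ab st smu sK; have ok' := st_ok st.
have [v [qv tvv epsv]] := star_scale F ok ab st.
have kv c d i k : kern (st_map (s := S) c) (st_map d) i k = v%:R * kern c d i k.
  exact: (star_kernel ok st tvv epsv).
have mapE := st_inj st; have nodeE := st_nodeE st.
have mapD d : st_map (s := S) d \in component b a by apply/(st_image st); exists d.
have ab' : a != b by move: ab; rewrite adjacentE // => /andP[].
have bD : b \notin component b a by apply/negP => /(component_nb ab'); rewrite eqxx.
have nodeE' d : (d == st_node S) = (st_map d == a).
  by rewrite -nodeE; apply/eqP/eqP => [->//|/mapE].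
set nu := nu_star b a (emb u).
have fnu : fin_seq nu by apply: nu_star_fin_seq.
set D := component b a.
set B := fun m : {ffun node g -> T} => [forall (c | c \notin D), m c == background b u c].
have Bb m : B m -> m b = u.
  by move=> /'forall_implyP /(_ b bD) /eqP ->; rewrite ffunE eqxx.
have B0 m c : B m -> c \notin D -> c != b -> m c = [ffun=> ord0].
  by move=> /'forall_implyP H cD /negPf cb; rewrite (eqP (H c cD)) ffunE cb.
pose e (m : {ffun node g -> T}) := fun d : node (st_alg S) => emb (m (st_map d)).
have pullE (c d : node (st_alg S)) (w : T) i :
   pull (st_map c) (st_map d) w i = v%:R * pull c d w i :> rat.
  by rewrite /pull mulr_sumr; apply: eq_bigr => k _; rewrite kv mulrA.
have farb c : c \in D -> c != a -> ~~ adjacent c b.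
  by move=> cD ca; apply: contra ca => cb; apply/eqP; apply: component_adjacent cD cb.
have vacE m : B m -> forall d i, vacancy (at_node (st_node S) nu) (e m) d i = vac0 m (st_map d) i.
  move=> Bm d i; rewrite (vacancy_emb _ _ (fun d => m (st_map d))) /vac0 nodeE'.
  have vn0 : (v * tv d)%:R != 0 :> rat by rewrite -tvv pnatr_eq0 -lt0n tv_gt0.
  have -> : \sum_d' pull (st_map d) d' (m d') i =
      pull (st_map d) b u i + v%:R * \sum_d' pull d d' (m (st_map d')) i.
    rewrite (bigD1 b) //= Bb //; congr (_ + _).
    rewrite (bigID (mem D)) /= [X in _ + X]big1 ?addr0 => [|c /andP[cb cD]]; last first.
      by rewrite (B0 m) // pull0.
    rewrite mulr_sumr; under [RHS]eq_bigr => d' _ do rewrite -pullE.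
    rewrite -(big_star _ (fun c => pull (st_map d) c (m c) i) st).
    by apply: eq_bigl => c; rewrite andbC /D; case cD: (c \in _) => //=; rewrite (component_nb ab' cD).
  rewrite tvv natrM invfM mulrDr opprD.
  have -> : (v%:R^-1 * (tv d)%:R^-1) * (v%:R * (\sum_d' pull d d' (m (st_map d')) i))
     = (tv d)%:R^-1 * (\sum_d' pull d d' (m (st_map d')) i) :> rat.
    by move: vn0; rewrite natrM mulf_eq0 negb_or => /andP[v0 t0]; field; rewrite v0 t0.
  congr (_ - _); case: eqP => [da|/eqP da]; last by rewrite pull_far ?mulr0 ?oppr0 ?farb // (component_nb ab').
  by rewrite -invfM -natrM -tvv da ufill_nu_star.
have chE m : B m -> v%:R * charge (at_node (st_node S) nu) (e m) = comp_energy b a m.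
  move=> Bm; rewrite (charge_emb _ (fun d => m (st_map d))) // mulrBr /comp_energy mulrCA; congr (_ * _ + _).
    rewrite mulr_sumr (big_star _ _ st); apply: eq_bigr => c _.
    rewrite mulr_sumr (big_star _ _ st); apply: eq_bigr => d _.
    rewrite /energy mulr_sumr; apply: eq_bigr => j _; rewrite pullE; ring.
  rewrite (bigD1 a) /=; last by rewrite componentE connect0.
  rewrite [X in _ = _ + X]big1 ?addr0 => [|c /andP[cD ca]]; last by rewrite energy_far ?farb // (component_nb ab').
  rewrite mulrA -natrM -tvv nodeE Bb // /energy mulr_sumr -sumrN; apply: eq_bigr => k _.
  have vn0 : (tv a)%:R != 0 :> rat by rewrite pnatr_eq0 -lt0n tv_gt0.
  by rewrite ufill_nu_star //; field.
rewrite /calM /M_infty /mu_star.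
rewrite (fsum_inj (e := e) (B := B)).
- apply: eq_big => [m|m].
    apply/andP/andP => -[Bm].
      move/asboolP/(admissible_at _ _ _ _ ok') => [_ H2 H3]; split=> //.
      apply/'forall_implyP => c /(st_image st) [d <-]; apply/andP; split.
        rewrite -(eqr_nat rat) -smu epsv -H3 wtE; exact: eqxx.
      by apply/asboolP => i i0; rewrite -vacE // H2.
    move/'forall_implyP => H; split=> //; apply/asboolP/(admissible_at _ _ _ _ ok').
    split=> [d|d i i0|d]; first exact: emb_fin.
      by rewrite vacE //; have /andP[_ /asboolP] := H _ (mapD d); apply.
    by have /andP[/eqP Hd _] := H _ (mapD d); rewrite wtE Hd -smu epsv.
  case/andP => Bm _; rewrite qv; congr (_ * _).
    have <- : v%:Z * Num.floor (charge (at_node (st_node S) nu) (e m)) = Num.floor (comp_energy b a m).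
      apply: (@intr_inj rat); rewrite rmorphM /= !floorK ?comp_energy_int //; last exact: charge_int.
      by rewrite -pmulrn chE.
    by rewrite -exprz_exp -exprnP.
  rewrite (big_star _ _ st); apply: eq_bigr => d _; rewrite /qpart.
  rewrite (prod_pos_emb (m (st_map d)) (f := fun i n =>
     qbin ((q ^+ v) ^+ tv d) (Num.truncn (vacancy (at_node (st_node S) nu) (e m) d i)) n)) => [|i]; last exact: qbin0.
  by apply: eq_bigr => j _; rewrite vacE // tvv exprM.
- move=> m m' Bm Bm' E; apply/ffunP => c.
  have [cD|cD] := boolP (c \in D); last first.
    by move: Bm Bm' => /'forall_implyP H /'forall_implyP H'; rewrite (eqP (H c cD)) (eqP (H' c cD)).
  move: cD => /(st_image st) [d <-]; apply: emb_inj.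
  exact: (congr1 (fun f : node (st_alg S) -> nat -> nat => f d) E).
- move=> f /(admissible_at _ _ _ _ ok') [H1 _ H3].
  (* The preimage of [f] is transported to D_a along the identification and completed by the
     background. *)
  pose m : {ffun node g -> T} := [ffun c =>
    if [pick d | st_map (s := S) d == c] is Some d then cut K (f d) else background b u c].
  exists m.
    apply/'forall_implyP => c cD; rewrite ffunE; case: pickP => // d /eqP dc.
    by rewrite -dc mapD in cD.
  apply/funext => d; rewrite /e ffunE; case: pickP => [d' /eqP/mapE ->|/(_ d)];
    last by rewrite eqxx.
  by apply: weight_bound (H1 d) _ (sK (st_map d)); rewrite H3 -epsv smu.
Qed.

End Star.

(** * Factorization along the components of the diagram without b *)

Lemma component_step g (b a c d : node g) : a != b -> c \in component b a -> adjacent c d ->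
  d != b -> d \in component b a.
Proof.
move=> ab cD cd db; have cb := component_nb ab cD; move: cD; rewrite !componentE => cD.
by rewrite (connect_trans cD) // connect1 // /avoid /= cd cb db.
Qed.

Lemma adjacent_neq g (a b : node g) : affine_ok g -> adjacent a b -> a != b.
Proof. by move=> ok; rewrite adjacentE // => /andP[]. Qed.

Lemma big_components (R : Type) (idx : R) (op : Monoid.com_law idx) g (b : node g) (F : node g -> R) :
  affine_ok g ->
  \big[op/idx]_(c | c != b) F c = \big[op/idx]_(a | adjacent a b) \big[op/idx]_(c in component b a) F c.
Proof.
move=> ok; rewrite (exchange_big_dep (fun c => c != b)) /=; last first.
  by move=> a c ab /(component_nb (adjacent_neq ok ab)).
apply: eq_bigr => c cb; have [a ab ca] := component_exists ok cb.
rewrite (big_pred1 a) // => a' /=; apply/andP/eqP => [[a'b ca']|->//].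
exact: component_inj ca' ca.
Qed.

Lemma outside_components g (b c : node g) : affine_ok g ->
  [forall (a | adjacent a b), c \notin component b a] = (c == b).
Proof.
move=> ok; apply/'forall_implyP/eqP => [H|-> a ab].
  apply/eqP/negPn/negP => cb; have [a ab ca] := component_exists ok cb.
  by have := H a ab; rewrite ca.
by apply/negP => /(component_nb (adjacent_neq ok ab)); rewrite eqxx.
Qed.

Section Assemble.
Variable K : nat.
Notation T := {ffun 'I_K -> 'I_K.+1}.

Lemma vac0_local g (b a c : node g) (m m' : node g -> T) i : affine_ok g -> adjacent a b ->
  m b = m' b -> (forall d, d \in component b a -> m d = m' d) -> c \in component b a ->
  vac0 m c i = vac0 m' c i.
Proof.
move=> ok ab eb eD cD; rewrite /vac0; congr (- (_ * _)); apply: eq_bigr => d _.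
have [->|db] := eqVneq d b; first by rewrite eb.
have [dD|dD] := boolP (d \in component b a); first by rewrite eD.
have ncd : ~~ adjacent c d.
  by apply: contra dD => cd; apply: component_step cD cd db; apply: adjacent_neq.
have cd : c != d by apply: contra dD => /eqP <-.
by rewrite !pull_far.
Qed.

Lemma psi_emb (u : T) : psi (emb u) = (\sum_(j < K) \sum_(k < K) minn j.+1 k.+1 * u j * u k)%N.
Proof.
rewrite /psi (sum_pos_emb u (F := fun i n => sum_pos (fun j => (minn i j * n * emb u j)%N))) => [|i].
  apply: eq_bigr => j _.
  rewrite (sum_pos_emb u (F := fun i n => (minn j.+1 i * u j * n)%N)) // => i; exact: muln0.
by apply: sum_pos0 => j; rewrite muln0.
Qed.

Lemma energy_node g (b : node g) (u : T) : affine_ok g ->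
  2^-1 * energy b b u u = (tv b * psi (emb u) %/ eps b)%:R.
Proof.
move=> ok; rewrite -{1}(divnK (eps_dvd_tv b ok)) mulnAC mulnK ?eps_gt0 //.
rewrite psi_emb natrM natr_sum !mulr_sumr; apply: eq_bigr => j _.
rewrite natr_sum !mulr_sumr; apply: eq_bigr => k _.
by rewrite kern_diag // !natrM; field.
Qed.

(** Different components have no common edge, so their mutual energies vanish. The row and the
    column of b contribute equally by symmetry, which cancels the factor 1/2 in front of the
    interaction with b. *)
Lemma energy_split g (b : node g) (m : node g -> T) : affine_ok g ->
  2^-1 * (\sum_c \sum_d energy c d (m c) (m d)) =
  (tv b * psi (emb (m b)) %/ eps b)%:R + \sum_(a | adjacent a b) comp_energy b a m.
Proof.
move=> ok; rewrite -energy_node //.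
have comp a c : adjacent a b -> c \in component b a ->
    \sum_d energy c d (m c) (m d) = energy c b (m c) (m b) +
      \sum_(d in component b a) energy c d (m c) (m d).
  move=> ab cD; have ab' := adjacent_neq ok ab; rewrite (bigD1 b) //=; congr (_ + _).
  rewrite (bigID (mem (component b a))) /= [X in _ + X]big1 ?addr0 => [|d /andP[db dD]].
    by apply: eq_bigl => d; rewrite andbC; case dD: (d \in _) => //=; rewrite (component_nb ab' dD).
  rewrite energy_far //; first by apply: contra dD => /eqP <-.
  by apply: contra dD => cd; apply: component_step cD cd db.
rewrite (bigD1 b) //= (bigD1 b) //= (big_components _ _ _ ok) [X in _ + _ + X](big_components _ _ _ ok).
have -> : \sum_(a | adjacent a b) \sum_(c in component b a) \sum_d energy c d (m c) (m d) =
   \sum_(a | adjacent a b) \sum_(c in component b a) energy b c (m b) (m c) +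
   \sum_(a | adjacent a b) \sum_(c in component b a) \sum_(d in component b a) energy c d (m c) (m d).
  rewrite -big_split; apply: eq_bigr => a ab; rewrite -big_split; apply: eq_bigr => c cD /=.
  by rewrite (comp a) // energy_sym.
rewrite /comp_energy [X in _ = _ + X]big_split /= -mulr_sumr.
under [X in _ = _ + (_ + X)]eq_bigr => a ab do under eq_bigr => c cD do rewrite energy_sym.
by field.
Qed.

Lemma sum_fseq_finite (F : fieldType) (q : F) g (b : node g) (mu : node g -> rat)
    (s : node g -> nat) (S : node g -> star_datum g) :
  q != 0 -> affine_ok g -> (forall a, adjacent a b -> is_star b a (S a)) ->
  (forall c, (eps c)%:R * mu c = (s c)%:R) -> (forall c, s c <= K)%N ->
  \sum_(nu \in [set nu : nat -> nat |
             fin_seq nu /\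
             sum_pos (fun i => i%:R * (nu i)%:R) = (eps b)%:R * mu b])
       (q ^+ (tv b * psi nu %/ eps b)
        / prod_pos (fun i => qpoch (q ^+ tv b) (nu i))
        * \prod_(a : node g | adjacent a b)
            calM (st_node (S a)) (nu_star b a nu)
              (mu_star mu (S a)) (q_star q a (S a))) =
  \sum_(m : {ffun node g -> T} | [forall c, wt (m c) == s c] &&
      [forall (c | c != b), `[< forall i, (0 < i)%N -> 0 <= vac0 m c i >]])
    q ^ Num.floor (2^-1 * \sum_c \sum_d energy c d (m c) (m d)) *
    ((\prod_(j < K) qpoch (q ^+ tv b) (m b j))^-1 * \prod_(c | c != b) qpart q (vac0 m) m c).
Proof.
move=> q0 ok st smu sK.
rewrite (fsum_inj (e := emb (K := K)) (B := xpredT)); first last.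
- by move=> f [ff fs]; exists (cut K f) => //; apply: weight_bound ff _ (sK b); rewrite fs smu.
- by move=> u v _ _; apply: emb_inj.
(* Configurations are grouped by their content at b, which is the summation variable nu of the
   limit. *)
rewrite [RHS](partition_big (fun m : {ffun node g -> T} => m b) (fun u => wt u == s b)) /=; last first.
  by move=> m /andP[/forallP H _].
apply: eq_big => [u|u us].
  apply/asboolP/eqP => [[_]|us]; last by split; [exact: emb_fin | rewrite wtE us smu].
  by rewrite wtE smu => /eqP; rewrite eqr_nat => /eqP.
have {}us : wt u = s b.
  by case/asboolP: us => _; rewrite wtE smu => /eqP; rewrite eqr_nat => /eqP.
under eq_bigr => a ab do rewrite (calM_finite _ q0 ok ab (st a ab) smu sK).
(* Each summand over D_a also sees the content of b; b is the only vertex outside all D_a, so this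
   is the dependence on common values that gluing allows. *)
rewrite (@prod_sum_glue _ _ _ _ (background b u) (fun a => adjacent a b) (component b)
  (fun a (m : {ffun node g -> T}) => [forall (c | c \in component b a),
     (wt (m c) == s c) && `[< forall i, (0 < i)%N -> 0 <= vac0 m c i >]])
  (fun a (m : {ffun node g -> T}) => q ^ Num.floor (comp_energy b a m) * \prod_(c in component b a) qpart q (vac0 m) m c)); first last.
- move=> a m m' ab E.
  have eb : m b = m' b by apply: E; rewrite outside_components // eqxx orbT.
  have eD c : c \in component b a -> m c = m' c by move=> cD; apply: E; rewrite cD.
  have ev c i : c \in component b a -> vac0 m c i = vac0 m' c i.
    exact: vac0_local ok ab eb eD.
  split.
    apply: eq_forallb => c; case cD: (c \in _) => //=; rewrite eD //; congr (_ && _).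
    by apply: asbool_equiv_eq; split=> H i i0; [rewrite -ev|rewrite ev] => //; apply: H.
  congr (_ ^ Num.floor _ * _).
    congr (_ * _ + _); [|apply: eq_bigr => c cD; by rewrite eb eD].
    by apply: eq_bigr => c cD; apply: eq_bigr => d dD; rewrite !eD.
  by apply: eq_bigr => c cD; apply: eq_bigr => j _; rewrite ev // eD.
- by move=> a a' c ab a'b; apply: component_inj.
rewrite big_distrr /=; apply: eq_big => [m|m].
  have -> : [forall (i | [forall (a | adjacent a b), i \notin component b a]), m i == background b u i] = (m b == u).
    apply/'forall_implyP/eqP => [H|mu_b i].
      by apply/eqP; have := H b; rewrite outside_components // eqxx ffunE eqxx; apply.
    by rewrite outside_components // => /eqP ->; rewrite ffunE eqxx mu_b.
  rewrite andbC; case: eqP => [mb|]; rewrite ?andbF //= !andbT.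
  apply/'forall_implyP/andP => [H|[/forallP H /'forall_implyP H'] a ab].
    have {}H c : c != b -> (wt (m c) == s c) && `[< forall i, (0 < i)%N -> 0 <= vac0 m c i >].
      move=> cb; have [a ab ca] := component_exists ok cb.
      by have /'forall_implyP := H a ab; apply.
    split; last by apply/'forall_implyP => c /H /andP[].
    by apply/forallP => c; have [->|/H/andP[]//] := eqVneq c b; rewrite mb us.
  apply/'forall_implyP => c ca; rewrite H H' //.
  exact: component_nb (adjacent_neq ok ab) ca.
case/andP => /'forall_implyP H _.
have mb : m b = u.
  by apply/eqP; have := H b; rewrite outside_components // eqxx ffunE eqxx; apply.
rewrite (prod_pos_emb u (f := fun i n => qpoch (q ^+ tv b) n)) => [|i]; last by rewrite /qpoch big_nil.
rewrite big_split /= -(big_components _ _ _ ok) mb.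
rewrite mulrACA; congr (_ * _).
have -> : \prod_(a | adjacent a b) q ^ Num.floor (comp_energy b a m) =
    q ^ (\sum_(a | adjacent a b) Num.floor (comp_energy b a m)).
  by symmetry; apply: (big_morph (fun z => q ^ z)) => // x y; rewrite expfzDr.
rewrite exprnP -expfzDr //; congr (_ ^ _); apply: (@intr_inj rat).
rewrite rmorphD /= floorK ?half_energy_int // (energy_split b) // mb rmorph_sum /= -pmulrn; congr (_ + _).
by apply: eq_bigr => a _; rewrite floorK ?comp_energy_int.
Qed.

End Assemble.

(** * q-adic limits *)

(** The valuation ring Q[q]_(q) of the q-adic valuation. *)
Definition regular (x : ratfun) : Prop :=
  exists f h : {poly rat}, h.[0] != 0 /\ x = tofrac f / tofrac h.

Lemma tofrac_neq0 (h : {poly rat}) : h.[0] != 0 -> tofrac h != 0.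
Proof. by move=> h0; rewrite tofrac_eq0; apply: contra h0 => /eqP ->; rewrite horner0. Qed.

Lemma regular_poly (f : {poly rat}) : regular (tofrac f).
Proof. by exists f, 1; rewrite hornerC oner_neq0; split=> //; rewrite tofrac1 divr1. Qed.

Lemma regularD x y : regular x -> regular y -> regular (x + y).
Proof.
move=> [f [h [h0 ->]]] [f' [h' [h'0 ->]]]; exists (f * h' + f' * h), (h * h').
rewrite hornerM mulf_neq0 //; split=> //.
by rewrite addf_div ?tofrac_neq0 // tofracD !tofracM.
Qed.

Lemma regularM x y : regular x -> regular y -> regular (x * y).
Proof.
move=> [f [h [h0 ->]]] [f' [h' [h'0 ->]]]; exists (f * f'), (h * h').
by rewrite hornerM mulf_neq0 //; split=> //; rewrite mulf_div !tofracM.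
Qed.

Lemma regular0 : regular 0. Proof. by rewrite -tofrac0; apply: regular_poly. Qed.
Lemma regular1 : regular 1. Proof. by rewrite -tofrac1; apply: regular_poly. Qed.

Lemma regular_prod (I : Type) (r : seq I) (P : pred I) (F : I -> ratfun) :
  (forall i, P i -> regular (F i)) -> regular (\prod_(i <- r | P i) F i).
Proof. by move=> H; apply: big_ind => //; [exact: regular1|exact: regularM]. Qed.

Lemma regularN x : regular x -> regular (- x).
Proof. by move=> [f [h [h0 ->]]]; exists (- f), h; rewrite tofracN mulNr. Qed.

Lemma qvarX n : qvar ^+ n = tofrac ('X^n : {poly rat}).
Proof. by rewrite tofracXn. Qed.

Lemma qvar_neq0 : qvar != 0.
Proof. by rewrite tofrac_eq0 polyX_eq0. Qed.

Lemma regular_qvarX n : regular (qvar ^+ n).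
Proof. by rewrite qvarX; apply: regular_poly. Qed.

Lemma regular_inv n : (0 < n)%N -> regular (1 - qvar ^+ n)^-1.
Proof.
move=> n0; exists 1, (1 - 'X^n); rewrite tofracB tofrac1 -qvarX mul1r; split=> //.
by rewrite !hornerE expr0n; case: n n0 => //= n _; rewrite subr0 oner_neq0.
Qed.

Lemma regular_1B n : regular (1 - qvar ^+ n).
Proof. by apply: regularD; [exact: regular1|apply/regularN/regular_qvarX]. Qed.

Lemma qadic_cvgP (u : nat -> ratfun) l : qadic_cvg u l <->
  forall N, exists L0, forall L, (L0 <= L)%N -> exists2 z, regular z & u L - l = qvar ^+ N * z.
Proof.
split=> H N; have [L0 HL] := H N; exists L0 => L /HL.
  by case=> f [h [h0 e]]; exists (tofrac f / tofrac h) => //; exists f, h.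
by case=> _ [f [h [h0 ->]]] e; exists f, h.
Qed.

Lemma qadic_cvg_cst c : qadic_cvg (fun=> c) c.
Proof.
apply/qadic_cvgP => N; exists 0%N => L _; exists 0; first exact: regular0.
by rewrite subrr mulr0.
Qed.

Lemma qadic_cvg_eventually u v l L1 : (forall L, (L1 <= L)%N -> u L = v L) ->
  qadic_cvg v l -> qadic_cvg u l.
Proof.
move=> uv H N; have [L0 HL] := H N; exists (maxn L0 L1) => L; rewrite geq_max => /andP[h0 h1].
by rewrite uv //; apply: HL.
Qed.

Lemma qadic_cvgD u v l k : qadic_cvg u l -> qadic_cvg v k -> qadic_cvg (fun L => u L + v L) (l + k).
Proof.
move=> /qadic_cvgP H /qadic_cvgP H'; apply/qadic_cvgP => N.
have [L0 HL] := H N; have [L1 HL'] := H' N.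
exists (maxn L0 L1) => L; rewrite geq_max => /andP[/HL[z rz ez] /HL'[z' rz' ez']].
by exists (z + z'); [exact: regularD | rewrite mulrDr -ez -ez'; ring].
Qed.

Lemma qadic_cvg_sum (I : Type) (r : seq I) (P : pred I) (u : I -> nat -> ratfun) l :
  (forall i, P i -> qadic_cvg (u i) (l i)) ->
  qadic_cvg (fun L => \sum_(i <- r | P i) u i L) (\sum_(i <- r | P i) l i).
Proof.
move=> H; elim: r => [|i r IH].
  by rewrite big_nil; under [X in qadic_cvg X]funext do rewrite big_nil; apply: qadic_cvg_cst.
rewrite big_cons; under [X in qadic_cvg X]funext do rewrite big_cons.
by case: ifP => // Pi; apply: qadic_cvgD => //; apply: H.
Qed.

(** The coefficient may have a pole at q = 0 of order at most e, at the price of asking for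
    precision N + e. This avoids proving that the energies are nonnegative. *)
Lemma qadic_cvgZ c e u l : regular (qvar ^+ e * c) -> qadic_cvg u l ->
  qadic_cvg (fun L => c * u L) (c * l).
Proof.
move=> rc /qadic_cvgP H; apply/qadic_cvgP => N; have [L0 HL] := H (N + e)%N.
exists L0 => L /HL [z rz ez]; exists (qvar ^+ e * c * z); first exact: regularM.
by rewrite -mulrBr ez exprD; ring.
Qed.

(** The asymmetric hypotheses are those needed for uv - lk = u (v - k) + (u - l) k. *)
Lemma qadic_cvgM u v l k : (forall L, regular (u L)) -> regular k ->
  qadic_cvg u l -> qadic_cvg v k -> qadic_cvg (fun L => u L * v L) (l * k).
Proof.
move=> ru rk /qadic_cvgP H /qadic_cvgP H'; apply/qadic_cvgP => N.
have [L0 HL] := H N; have [L1 HL'] := H' N.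
exists (maxn L0 L1) => L; rewrite geq_max => /andP[/HL[z rz ez] /HL'[z' rz' ez']].
exists (u L * z' + z * k); first by apply: regularD; apply: regularM.
rewrite mulrDr [qvar ^+ N * (z * k)]mulrA -ez mulrCA -ez'; ring.
Qed.

Lemma qadic_cvg_prod (I : Type) (r : seq I) (P : pred I) (u : I -> nat -> ratfun) l :
  (forall i L, P i -> regular (u i L)) -> (forall i, P i -> regular (l i)) ->
  (forall i, P i -> qadic_cvg (u i) (l i)) ->
  qadic_cvg (fun L => \prod_(i <- r | P i) u i L) (\prod_(i <- r | P i) l i).
Proof.
move=> ru rl H; elim: r => [|i r IH].
  by rewrite big_nil; under [X in qadic_cvg X]funext do rewrite big_nil; apply: qadic_cvg_cst.
rewrite big_cons; under [X in qadic_cvg X]funext do rewrite big_cons.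
case: ifP => // Pi; apply: qadic_cvgM => //; [by move=> L; apply: ru| |exact: H].
exact: regular_prod.
Qed.

Lemma qbinE (x : ratfun) p m :
  qbin x p m = \prod_(i < m) ((1 - x ^+ (p + i.+1)) / (1 - x ^+ i.+1)).
Proof. by rewrite /qbin big_add1 big_mkord. Qed.

Lemma qpochVE (x : ratfun) m : (qpoch x m)^-1 = \prod_(i < m) (1 - x ^+ i.+1)^-1.
Proof. by rewrite /qpoch prodfV big_add1 big_mkord. Qed.

Lemma regular_qbin t p m : (0 < t)%N -> regular (qbin (qvar ^+ t) p m).
Proof.
move=> t0; rewrite qbinE; apply: regular_prod => i _.
rewrite -!exprM; apply: regularM; first exact: regular_1B.
by apply: regular_inv; rewrite muln_gt0 t0.
Qed.

Lemma regular_qpochV t m : (0 < t)%N -> regular (qpoch (qvar ^+ t) m)^-1.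
Proof.
move=> t0; rewrite qpochVE; apply: regular_prod => i _.
by rewrite -exprM; apply: regular_inv; rewrite muln_gt0 t0.
Qed.

Lemma qadic_cvg_qbin t m (p : nat -> nat) : (0 < t)%N ->
  (forall N, exists L0, forall L, (L0 <= L)%N -> (N <= p L)%N) ->
  qadic_cvg (fun L => qbin (qvar ^+ t) (p L) m) (qpoch (qvar ^+ t) m)^-1.
Proof.
move=> t0 pinf; rewrite qpochVE; under [X in qadic_cvg X]funext do rewrite qbinE.
have ti i : (0 < t * i.+1)%N by rewrite muln_gt0 t0.
apply: qadic_cvg_prod => [i L _|i _|i _].
- by rewrite -!exprM; apply: regularM; [exact: regular_1B | exact: regular_inv].
- by rewrite -exprM; exact: regular_inv.
apply/qadic_cvgP => N; have [L0 HL] := pinf N; exists L0 => L /HL Np.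
(* With x = q^t, a factor differs from its limit by - x^(p + i + 1) / (1 - x^(i + 1)), and t (p + i
   + 1) exceeds N. *)
exists (- (qvar ^+ (t * (p L + i.+1) - N) * (1 - qvar ^+ (t * i.+1))^-1)).
  by apply/regularN/regularM; [exact: regular_qvarX | exact: regular_inv].
rewrite mulrN mulrA -exprD subnKC; last by nia.
by rewrite -!exprM mulrBl mul1r; ring.
Qed.

(** Uniformity in i is needed since admissibility tests every i; it holds because min(t_d i, t_b k)
    <= t_b k. *)
Lemma vac0_bounded K g (b : node g) (m : node g -> {ffun 'I_K -> 'I_K.+1}) : affine_ok g ->
  exists C : nat, forall i, - C%:R <= vac0 m b i.
Proof.
move=> ok.
pose C : rat := (tv b)%:R^-1 * \sum_d \sum_(k < K) `|form b d| * (t b * k.+1)%:R * (m d k)%:R.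
have C0 : 0 <= C by rewrite mulr_ge0 ?invr_ge0 // sumr_ge0 // => d _; rewrite sumr_ge0 // => k _; rewrite !mulr_ge0.
exists (Num.truncn C).+1 => i; rewrite /vac0 lerN2 (@le_trans _ _ C) //; last first.
  by have /andP[_ /ltW] := truncn_itv C0.
rewrite ler_wpM2l ?invr_ge0 //; apply: ler_sum => d _; apply: ler_sum => k _.
rewrite ler_wpM2r // /kern (le_trans (ler_norm _)) // normrM ler_wpM2l //.
by rewrite ger0_norm // ler_nat geq_minr.
Qed.

Lemma qadic_cvg_M_infty K g (b : node g) l (s : node g -> nat) : affine_ok g -> (0 < l)%N ->
  qadic_cvg (fun L => \sum_(m : {ffun node g -> {ffun 'I_K -> 'I_K.+1}} | [forall c, wt (m c) == s c] &&
      `[< forall c i, (0 < i)%N -> 0 <= lvac b l L m c i >])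
    qvar ^ Num.floor (2^-1 * \sum_c \sum_d energy c d (m c) (m d)) * \prod_c qpart qvar (lvac b l L m) m c)
  (\sum_(m : {ffun node g -> {ffun 'I_K -> 'I_K.+1}} | [forall c, wt (m c) == s c] &&
      [forall (c | c != b), `[< forall i, (0 < i)%N -> 0 <= vac0 m c i >]])
    qvar ^ Num.floor (2^-1 * \sum_c \sum_d energy c d (m c) (m d)) *
    ((\prod_(j < K) qpoch (qvar ^+ tv b) (m b j))^-1 * \prod_(c | c != b) qpart qvar (vac0 m) m c)).
Proof.
move=> ok l0.
(* The configurations form a finite type, so one constant serves for all of them. *)
have [C CP] : exists C : nat, forall (m : {ffun node g -> {ffun 'I_K -> 'I_K.+1}}) i, - C%:R <= vac0 m b i.
  have /choice [C HC] := fun m : {ffun node g -> {ffun 'I_K -> 'I_K.+1}} => vac0_bounded b m ok.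
  exists (\max_m C m) => m i; apply: le_trans (HC m i).
  by rewrite lerN2 ler_nat leq_bigmax.
have lvac_ne (m : {ffun node g -> {ffun 'I_K -> 'I_K.+1}}) L c i : c != b -> lvac b l L m c i = vac0 m c i.
  by move=> /negPf cb; rewrite /lvac cb add0r.
have lvac_ge (m : {ffun node g -> {ffun 'I_K -> 'I_K.+1}}) L i : (0 < i)%N -> (L%:R : rat) - C%:R <= lvac b l L m b i.
  move=> i0; rewrite /lvac eqxx lerD // ler_nat -{1}(muln1 L) leq_mul2l.
  by rewrite leq_min i0 l0 orbT.
(* For L >= C the constraint at b holds automatically, because min(i, l) >= 1 gives a vacancy of at
   least L - C; the index set then no longer depends on L. *)
apply: (@qadic_cvg_eventually _ (fun L => \sum_(m : {ffun node g -> {ffun 'I_K -> 'I_K.+1}} | [forall c, wt (m c) == s c] &&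
      [forall (c | c != b), `[< forall i, (0 < i)%N -> 0 <= vac0 m c i >]])
    (qvar ^ Num.floor (2^-1 * \sum_c \sum_d energy c d (m c) (m d)) *
      \prod_(c | c != b) qpart qvar (vac0 m) m c) * qpart qvar (lvac b l L m) m b) _ C).
  move=> L CL; apply: eq_big => [m|m _].
    congr (_ && _); apply/asboolP/'forall_implyP => [H c cb|H c i i0].
      by apply/asboolP => i i0; rewrite -(lvac_ne m L c) //; apply: H.
    have [->|cb] := eqVneq c b; last by rewrite lvac_ne //; have /asboolP := H c cb; apply.
    by apply: le_trans (lvac_ge m L i i0); rewrite subr_ge0 ler_nat.
  rewrite [\prod_c _](bigD1 b) //= [X in _ * X = _]mulrC mulrA; congr (_ * _ * _).
  by apply: eq_bigr => c cb; apply: eq_bigr => j _; rewrite lvac_ne.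
apply: qadic_cvg_sum => m _; rewrite [X in qadic_cvg _ (_ * X)]mulrC mulrA.
(* A negative exponent of q, if any, is cleared by [e], which depends on the configuration but not
   on L. *)
have [e re] : exists e, regular (qvar ^+ e * (qvar ^ Num.floor (2^-1 * \sum_c \sum_d energy c d (m c) (m d)) *
      \prod_(c | c != b) qpart qvar (vac0 m) m c)).
  have rq : regular (\prod_(c | c != b) qpart qvar (vac0 m) m c).
    by apply: regular_prod => c _; apply: regular_prod => j _; apply: regular_qbin; apply: tv_gt0.
  case: (Num.floor _) => n; [exists 0%N|exists n.+1]; rewrite mulrA; apply: regularM => //.
    by rewrite expr0 mul1r -exprnP; apply: regular_qvarX.
  by rewrite NegzE -exprnN mulfV ?expf_neq0 ?qvar_neq0 //; apply: regular1.
apply: qadic_cvgZ re _; rewrite -prodfV /qpart.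
apply: qadic_cvg_prod => [j L _|j _|j _].
- by apply: regular_qbin; apply: tv_gt0.
- by apply: regular_qpochV; apply: tv_gt0.
apply: qadic_cvg_qbin; first exact: tv_gt0.
move=> N; exists (C + N)%N => L CNL; rewrite truncn_ge_nat; last first.
  by apply: le_trans (lvac_ge m L j.+1 isT); rewrite subr_ge0 ler_nat; lia.
apply: le_trans (lvac_ge m L j.+1 isT); rewrite lerBrDr -natrD ler_nat; lia.
Qed.

Theorem proposition4p8 (g : affine) (hg : affine_ok g)
    (b : node g) (l : nat) (hl : (1 <= l)%N)
    (mu : node g -> rat)
    (hmu : forall c : node g, exists k : nat, (eps c)%:R * mu c = k%:R)
    (S : node g -> star_datum g)
    (hS : forall a : node g, adjacent a b -> is_star b a (S a)) :
  qadic_cvg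
    (fun L : nat =>
       M_infty (at_node b (fun j => if j == l then L else 0%N))
         ((L * l)%:R *: Lam b - \sum_(c : node g) mu c *: alpha c)
         (qvar ^-1))
    (\sum_(nu \in [set nu : nat -> nat |
             fin_seq nu /\
             sum_pos (fun i => i%:R * (nu i)%:R) = (eps b)%:R * mu b])
       (qvar ^+ (tv b * psi nu %/ eps b)
        / prod_pos (fun i => qpoch (qvar ^+ tv b) (nu i))
        * \prod_(a : node g | adjacent a b)
            calM (st_node (S a)) (nu_star b a nu)
              (mu_star mu (S a)) (q_star qvar a (S a)))).
Proof.
(* The integers s_c = eps_c mu_c are the weights of the m^(c); K bounds them all, including that of
   nu = m^(b). *)
have [s smu] := choice hmu; pose K := \max_c s c.
have sK c : (s c <= K)%N by rewrite /K leq_bigmax.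
rewrite (sum_fseq_finite qvar_neq0 hg hS smu sK).
under [X in qadic_cvg X]funext => L do rewrite (M_inftyV_finite b L qvar_neq0 hg hl smu sK).
exact: qadic_cvg_M_infty.
Qed.
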